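(* Let $0<\varepsilon<1$ and $C>0$ be given constants. Assume that $M$ is a real orthogonal $n\times n$ matrix with $s_0(M)\ge n^{-C}$. Then all but $O(n^{1-\varepsilon})$ rows of $M$ contain a (unique) entry of absolute value at least $1-O(n^{-1+\varepsilon})$, where the implied constants depend only on $C$ and $\varepsilon$.
   Context: $\mathcal{C}_n=\{-1,1\}^n\subset\mathbf{R}^n$ denotes the Boolean hypercube. For a real $n\times n$ matrix $M$, the exact score function is $s_0(M):=\mathbf{P}_{\mathbf{x}\in\mathcal{C}_n}(M\mathbf{x}\in\mathcal{C}_n)$, where $\mathbf{x}$ is chosen uniformly at random from $\mathcal{C}_n$. *)

(* Defs.v *)
From HB Require Import structures.
From mathcomp Require Import all_boot all_order all_algebra.
From mathcomp Require Import all_classical all_reals all_analysis.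

Set Implicit Arguments.
Unset Strict Implicit.
Unset Printing Implicit Defensive.

Import Order.TTheory GRing.Theory Num.Theory.
Local Open Scope ring_scope.

Definition orthogonal_mx (R : realType) (n : nat) (M : 'M[R]_n) : Prop :=
  M^T *m M = 1%:M.

Definition hypercube (R : realType) (n : nat) : pred 'cV[R]_n :=
  [pred x : 'cV[R]_n | [forall i, (x i 0 == 1) || (x i 0 == -1)]].
Arguments hypercube : clear implicits.

(* The bijection 'cV[bool]_n -> hypercube R n (see [sign_col_inj] and
   [hypercubeP]), with true |-> -1: it lets the uniform distribution on the
   hypercube be computed by counting over a finite type. *)
Definition sign_col (R : realType) (n : nat) (b : 'cV[bool]_n) : 'cV[R]_n :=
  map_mx (fun c : bool => (-1) ^+ c) b.
Arguments sign_col : clear implicits.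

Lemma sign_col_inj (R : realType) (n : nat) : injective (sign_col R n).
Proof.
move=> b c /matrixP e; apply/matrixP => i j; have := e i j.
by rewrite !mxE; exact: signr_inj.
Qed.

Lemma hypercubeP (R : realType) (n : nat) (x : 'cV[R]_n) :
  reflect (exists b, x = sign_col R n b) (x \in hypercube R n).
Proof.
apply: (iffP forallP) => [h|[b ->] i]; last first.
  by rewrite mxE; case: (b i 0); rewrite ?expr0 ?expr1 eqxx ?orbT.
exists (map_mx (fun t : R => t == -1) x); apply/matrixP => i j.
rewrite (ord1 j) !mxE; case/orP: (h i) => /eqP ->; last by rewrite eqxx.
by rewrite -addr_eq0 (pnatr_eq0 R 2).
Qed.

Definition score0 (R : realType) (n : nat) (M : 'M[R]_n) : R :=
  #|[set b : 'cV[bool]_n | M *m sign_col R n b \in hypercube R n]|%:R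
  / #|{: 'cV[bool]_n}|%:R.

(* Main.v *)
Require Import Defs.
From mathcomp Require Import all_boot all_order all_algebra.
From mathcomp Require Import all_classical all_reals all_analysis.
From mathcomp Require Import ring lra zify.

(** Let x be a uniform random sign vector, f_i = (M x)_i, and call x preserved
    when every f_i is a sign.  Put t = n^((1 - eps) / 2); then n is at most a
    fixed power t^D of t, and x is preserved with probability at least t^-D.
    For each row i let p(i) be the position of its entry of largest absolute
    value.  Three ideas show that only O(t^2) rows i have
    |M_(i,p(i))| < 1 - t^-2.

    Energy.  The sum of the f_i^4 equals n when x is preserved, but its mean is
    n + 2 S, where S is the sum over the rows of 1 - sum_j M_ij^4.  Since the
    f_i^2 always add up to n, the discrete gradient of the quartic sum involves
    only the small quantities f_i^2 - 1, and the Poincare inequality bounds its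
    variance by O(S) ([quartic_variance]).  Hypercontractivity ([bonami],
    [high_moment]) then bounds the probability of being preserved by O(S^-q)
    for every fixed q, so that S = O(t) ([spread_bound]).  Hence all but O(t^2)
    rows have 1 - M_(i,p(i))^2 <= 1/t ([diffuse_rows_card]).

    Linear equations.  For such a peaked row, the entries other than the
    largest contribute less than 1 to f_i except with probability at most
    t^(-2D-1), up to a constant factor; when they do and x is preserved, f_i
    has to be the signed coordinate s_i x_(p(i)) with s_i the sign of
    M_(i,p(i)).  So x solves, with probability at least t^-D / 2, a homogeneous
    linear system, namely M - (signed injection) restricted to the peaked rows
    ([defect_kernel_mean]).  By a Littlewood-Offord inequality of Halasz type
    ([small_ball]), this is only possible if, for r = 2 (D + 1), some set J of
    O(t) coordinates can be deleted so that the system has rank less than r.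

    Trace.  On the peaked rows with p(i) outside J, the system becomes a square
    matrix 1 - M', where M' is a submatrix of M up to signs and order, hence a
    contraction.  A matrix of rank less than r and operator norm at most 2 has
    trace at most 2 r ([mxtrace_le_rank]), and this trace is the sum of the
    1 - |M_(i,p(i))| ([diagonal_defect]).  So at most 2 r t^2 of these rows
    have |M_(i,p(i))| < 1 - t^-2. *)

Set Implicit Arguments.
Unset Strict Implicit.
Unset Printing Implicit Defensive.

Import Order.TTheory GRing.Theory Num.Theory.
Local Open Scope ring_scope.

(** * Means over the discrete cube *)

Lemma cauchy_schwarz_sum (R : realFieldType) (I : Type) (r : seq I)
    (P : pred I) (a b : I -> R) :
  (\sum_(i <- r | P i) a i * b i) ^+ 2 <=
  (\sum_(i <- r | P i) a i ^+ 2) * (\sum_(i <- r | P i) b i ^+ 2).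
Proof.
have h : 0 <= \sum_(i <- r | P i) \sum_(j <- r | P j) (a i * b j - a j * b i) ^+ 2.
  by apply: sumr_ge0 => i _; apply: sumr_ge0 => j _; exact: sqr_ge0.
have e : \sum_(i <- r | P i) \sum_(j <- r | P j) (a i * b j - a j * b i) ^+ 2 =
  2 * ((\sum_(i <- r | P i) a i ^+ 2) * (\sum_(i <- r | P i) b i ^+ 2) -
       (\sum_(i <- r | P i) a i * b i) ^+ 2).
  have -> : 2 * ((\sum_(i <- r | P i) a i ^+ 2) * (\sum_(i <- r | P i) b i ^+ 2)
       - (\sum_(i <- r | P i) a i * b i) ^+ 2) =
     (\sum_(i <- r | P i) a i ^+ 2) * (\sum_(i <- r | P i) b i ^+ 2)
     + (\sum_(i <- r | P i) b i ^+ 2) * (\sum_(i <- r | P i) a i ^+ 2)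
     - 2 * ((\sum_(i <- r | P i) a i * b i) * (\sum_(i <- r | P i) a i * b i)).
    by ring.
  rewrite !big_distrlr /= [2 * _]mulr_sumr -big_split -sumrB.
  apply: eq_bigr => i _; rewrite mulr_sumr -big_split -sumrB /=.
  by apply: eq_bigr => j _; ring.
by move: h; rewrite e pmulr_rge0 // subr_ge0.
Qed.

Definition mean (R : realFieldType) n (F : 'cV[bool]_n -> R) : R :=
  (\sum_b F b) / 2 ^+ n.

Definition consb n (c : bool) (b : 'cV[bool]_n) : 'cV[bool]_n.+1 :=
  col_mx (const_mx c : 'cV_1) b.

Lemma consb0 n c (b : 'cV[bool]_n) : consb c b ord0 0 = c.
Proof.
rewrite /consb -[ord0](_ : lshift n (ord0 : 'I_1) = _); last exact/val_inj.
by rewrite [LHS]col_mxEu mxE.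
Qed.

Lemma consbS n c (b : 'cV[bool]_n) j : consb c b (lift ord0 j) 0 = b j 0.
Proof.
rewrite /consb -[lift _ _](_ : rshift 1 j = _); last exact/val_inj.
by rewrite [LHS]col_mxEd.
Qed.

Lemma sum_consb (V : nmodType) n (F : 'cV[bool]_n.+1 -> V) :
  \sum_b F b = \sum_(c : bool) \sum_b F (consb c b).
Proof.
rewrite pair_big /=.
rewrite (reindex (fun p : bool * 'cV[bool]_n => consb p.1 p.2)) //.
exists (fun b : 'cV[bool]_n.+1 => (b ord0 0, dsubmx (b : 'cV_(1 + n)))).
  by move=> [c b] _ /=; rewrite consb0 /consb col_mxKd.
move=> b _ /=; apply/matrixP => i k; rewrite (ord1 k).
case: (unliftP ord0 i) => [j ->|->]; last by rewrite consb0.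
by rewrite consbS mxE; congr (b _ _); apply/val_inj.
Qed.

Lemma mean_consb (R : realFieldType) n (F : 'cV[bool]_n.+1 -> R) :
  mean F = (mean (fun b => F (consb false b)) +
            mean (fun b => F (consb true b))) / 2.
Proof.
rewrite /mean sum_consb big_bool /= exprS.
have h : (2 : R) ^+ n != 0 by rewrite expf_neq0 // pnatr_eq0.
by field.
Qed.

Lemma mean_nil (R : realFieldType) (F : 'cV[bool]_0 -> R) (b : 'cV_0) :
  mean F = F b.
Proof.
rewrite /mean expr0 divr1 (big_pred1 b) // => c.
by apply/esym/eqP/matrixP => -[].
Qed.

Lemma mean_ge0 (R : realFieldType) n (F : 'cV[bool]_n -> R) :
  (forall b, 0 <= F b) -> 0 <= mean F.
Proof. by move=> h; rewrite divr_ge0 ?exprn_ge0 // sumr_ge0. Qed.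

Lemma ler_mean (R : realFieldType) n (F G : 'cV[bool]_n -> R) :
  (forall b, F b <= G b) -> mean F <= mean G.
Proof.
by move=> h; rewrite ler_pM2r ?invr_gt0 ?exprn_gt0 // ler_sum.
Qed.

Lemma eq_mean (R : realFieldType) n (F G : 'cV[bool]_n -> R) :
  F =1 G -> mean F = mean G.
Proof. by move=> h; rewrite /mean (eq_bigr G). Qed.

Lemma meanD (R : realFieldType) n (F G : 'cV[bool]_n -> R) :
  mean (fun b => F b + G b) = mean F + mean G.
Proof. by rewrite /mean big_split mulrDl. Qed.

Lemma meanZ (R : realFieldType) n (F : 'cV[bool]_n -> R) c :
  mean (fun b => c * F b) = c * mean F.
Proof. by rewrite /mean -mulr_sumr mulrA. Qed.

Lemma mean_cst (R : realFieldType) n (c : R) :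
  mean (fun _ : 'cV[bool]_n => c) = c.
Proof.
rewrite /mean sumr_const cardT -cardE card_mx card_bool muln1.
by rewrite -[c in LHS]mulr1 -mulrnAr natrX mulfK // expf_neq0 // pnatr_eq0.
Qed.

Lemma mean_sum (R : realFieldType) n (I : finType) (F : I -> 'cV[bool]_n -> R) :
  mean (fun b => \sum_i F i b) = \sum_i mean (F i).
Proof. by rewrite /mean exchange_big -mulr_suml. Qed.

Lemma mean_cauchy_schwarz (R : realFieldType) n (F G : 'cV[bool]_n -> R) :
  (mean (fun b => F b * G b)) ^+ 2 <=
  mean (fun b => F b ^+ 2) * mean (fun b => G b ^+ 2).
Proof.
rewrite /mean mulrACA expr_div_n -invfM -expr2.
by rewrite ler_pM2r ?invr_gt0 ?exprn_gt0 // cauchy_schwarz_sum.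
Qed.

(** * Hypercontractivity *)

(** [lowdeg d F] holds when F is a multilinear polynomial of degree at most d
    in the signs (-1)^(b_j).  Splitting off one coordinate at a time gives
    exactly the decomposition F = p + x q on which [bonami] is proved by
    induction. *)
Fixpoint lowdeg (R : realFieldType) n d : ('cV[bool]_n -> R) -> Prop :=
  match n with
  | 0 => fun=> True
  | n'.+1 => fun F => exists p q : 'cV[bool]_n' -> R,
      [/\ forall c b, F (consb c b) = p b + (-1) ^+ c * q b,
          lowdeg d p
        & if d is d'.+1 then lowdeg d' q else forall b, q b = 0]
  end.
Arguments lowdeg {R n}.

Lemma eq_lowdeg (R : realFieldType) n d (F G : 'cV[bool]_n -> R) :
  F =1 G -> lowdeg d F -> lowdeg d G.
Proof.
case: n F G => [//|n] F G h [p [q [e hp hq]]].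
by exists p, q; split=> // c b; rewrite -h.
Qed.

Lemma lowdeg_cst (R : realFieldType) n d (c : R) :
  lowdeg d (fun _ : 'cV[bool]_n => c).
Proof.
elim: n d c => [//|n IH] d c /=; exists (fun=> c), (fun=> 0); split => //.
- by move=> k b; rewrite mulr0 addr0.
- by case: d.
Qed.

Lemma lowdegW (R : realFieldType) n d e (F : 'cV[bool]_n -> R) :
  (d <= e)%N -> lowdeg d F -> lowdeg e F.
Proof.
elim: n d e F => [//|n IH] d e F le [p [q [E hp hq]]].
exists p, q; split => //; first exact: IH hp.
case: d le hp hq => [|d]; case: e => [|e] //= le hp hq; last exact: IH hq.
by apply: (eq_lowdeg _ (lowdeg_cst _ e 0)) => b; rewrite hq.
Qed.

Lemma lowdegD (R : realFieldType) n d (F G : 'cV[bool]_n -> R) :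
  lowdeg d F -> lowdeg d G -> lowdeg d (fun b => F b + G b).
Proof.
elim: n d F G => [//|n IH] d F G [p [q [E hp hq]]] [p' [q' [E' hp' hq']]].
exists (fun b => p b + p' b), (fun b => q b + q' b); split.
- by move=> c b; rewrite E E'; ring.
- exact: IH.
- case: d hp hp' hq hq' => [|d] _ _ hq hq'; last exact: IH.
  by move=> b; rewrite hq hq' addr0.
Qed.

Lemma lowdeg_sum (R : realFieldType) n d (I : finType)
    (F : I -> 'cV[bool]_n -> R) :
  (forall i, lowdeg d (F i)) -> lowdeg d (fun b => \sum_i F i b).
Proof.
move=> h; elim: (index_enum I) => [|i s IH].
  by apply: (eq_lowdeg _ (lowdeg_cst _ d 0)) => b; rewrite big_nil.
apply: (eq_lowdeg _ (lowdegD (h i) IH)) => b.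
by rewrite big_cons.
Qed.

Lemma lowdegM (R : realFieldType) n d e (F G : 'cV[bool]_n -> R) :
  lowdeg d F -> lowdeg e G -> lowdeg (d + e) (fun b => F b * G b).
Proof.
elim: n d e F G => [//|n IH] d e F G [p [q [E hp hq]]] [p' [q' [E' hp' hq']]].
exists (fun b => p b * p' b + q b * q' b),
       (fun b => p b * q' b + q b * p' b); split.
- by move=> c b; rewrite E E'; case: c; ring.
- apply: lowdegD; first exact: IH.
  case: d hp hq => [|d] hp hq.
    by apply: (eq_lowdeg _ (lowdeg_cst _ _ 0)) => b; rewrite hq mul0r.
  case: e hp' hq' => [|e] hp' hq'.
    by apply: (eq_lowdeg _ (lowdeg_cst _ _ 0)) => b; rewrite hq' mulr0.
  by apply: (@lowdegW _ _ (d + e)); [lia | exact: IH].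
case: d hp hq => [|d] hp hq; case: e hp' hq' => [|e] hp' hq'.
- by move=> b; rewrite hq hq' mulr0 mul0r addr0.
- rewrite add0n; apply: (@eq_lowdeg _ _ _ (fun b => p b * q' b)).
    by move=> b; rewrite hq mul0r addr0.
  by rewrite -[e]add0n; exact: IH.
- rewrite addn0; apply: (@eq_lowdeg _ _ _ (fun b => q b * p' b)).
    by move=> b; rewrite hq' mulr0 add0r.
  by rewrite -[d]addn0; exact: IH.
- rewrite addSn; apply: lowdegD.
    by rewrite addnS -addSn; exact: IH.
  by exact: IH.
Qed.

Lemma lowdegX (R : realFieldType) n d k (F : 'cV[bool]_n -> R) :
  lowdeg d F -> lowdeg (k * d) (fun b => F b ^+ k).
Proof.
move=> h; elim: k => [|k IH].
  by apply: (eq_lowdeg _ (lowdeg_cst _ _ 1)) => b; rewrite expr0.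
rewrite mulSn; apply: (eq_lowdeg _ (lowdegM h IH)) => b.
by rewrite exprS.
Qed.

Definition signsum (R : realFieldType) n (m : 'I_n -> R) (b : 'cV[bool]_n) : R :=
  \sum_j m j * (-1) ^+ (b j 0).

Lemma signsum_consb (R : realFieldType) n (m : 'I_n.+1 -> R) c b :
  signsum m (consb c b) =
  signsum (fun j => m (lift ord0 j)) b + (-1) ^+ c * m ord0.
Proof.
rewrite /signsum big_ord_recl consb0 addrC mulrC; congr (_ + _).
by apply: eq_bigr => j _; rewrite consbS.
Qed.

Lemma lowdeg_signsum (R : realFieldType) n (m : 'I_n -> R) :
  lowdeg 1 (signsum m).
Proof.
elim: n m => [//|n IH] m.
exists (signsum (fun j => m (lift ord0 j))), (fun=> m ord0); split => //.
- by move=> c b; rewrite signsum_consb.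
- exact: lowdeg_cst.
Qed.

(** Expand (p + x q)^4 and average over the sign x: the odd powers of x vanish,
    and Cauchy-Schwarz with the two induction hypotheses bounds the mixed term,
    6 mean (p^2 q^2) <= 18 9^(d-1) (mean p^2) (mean q^2), which fits exactly in
    the expansion of 9^d (mean p^2 + mean q^2)^2. *)
Lemma bonami (R : realFieldType) n d (F : 'cV[bool]_n -> R) : lowdeg d F ->
  mean (fun b => F b ^+ 4) <= 9 ^+ d * mean (fun b => F b ^+ 2) ^+ 2.
Proof.
elim: n d F => [|n IH] d F.
  move=> _; rewrite !(mean_nil _ 0) -exprM ler_peMl ?exprn_even_ge0 //.
  by rewrite exprn_ege1 // ler1n.
move=> [p [q [E hp hq]]].
have -> : mean (fun b => F b ^+ 2) =
  mean (fun b => p b ^+ 2) + mean (fun b => q b ^+ 2).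
  rewrite mean_consb; apply: canLR (mulfK _) _; first by rewrite pnatr_eq0.
  rewrite mulrC -!meanD -meanZ; apply: eq_mean => b; rewrite !E; ring.
have -> : mean (fun b => F b ^+ 4) =
  mean (fun b => p b ^+ 4) + 6 * mean (fun b => p b ^+ 2 * q b ^+ 2)
  + mean (fun b => q b ^+ 4).
  rewrite mean_consb; apply: canLR (mulfK _) _; first by rewrite pnatr_eq0.
  rewrite mulrC -meanZ -!meanD -meanZ; apply: eq_mean => b; rewrite !E; ring.
have hP := IH _ _ hp.
have P0 : 0 <= mean (fun b => p b ^+ 2) by apply: mean_ge0 => b; exact: sqr_ge0.
have Q0 : 0 <= mean (fun b => q b ^+ 2) by apply: mean_ge0 => b; exact: sqr_ge0.
have cs := mean_cauchy_schwarz (fun b => p b ^+ 2) (fun b => q b ^+ 2).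
have e4 (f : 'cV_n -> R) : mean (fun b => (f b ^+ 2) ^+ 2) = mean (fun b => f b ^+ 4).
  by apply: eq_mean => b; rewrite -exprM.
rewrite !e4 in cs.
have Z0 : 0 <= mean (fun b => p b ^+ 2 * q b ^+ 2).
  by apply: mean_ge0 => b; rewrite mulr_ge0 ?sqr_ge0.
set P := mean (fun b => p b ^+ 2) in hP P0 *.
set Q := mean (fun b => q b ^+ 2) in Q0 *.
case: d hp hq hP => [|d] hp hq hP.
  have -> : Q = 0.
    by rewrite /Q -[RHS](mean_cst n); apply: eq_mean => b; rewrite hq expr0n.
  have -> : mean (fun b => q b ^+ 4) = 0.
    by rewrite -[RHS](mean_cst n); apply: eq_mean => b; rewrite hq expr0n.
  have -> : mean (fun b => p b ^+ 2 * q b ^+ 2) = 0.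
    by rewrite -[RHS](mean_cst n); apply: eq_mean => b; rewrite hq expr0n mulr0.
  by rewrite mulr0 !addr0.
have hQ := IH _ _ hq; rewrite -/Q in hQ.
set c := (9 : R) ^+ d in hQ.
have c0 : 0 <= c by rewrite exprn_ge0.
rewrite exprS -/c in hP *.
have zle : mean (fun b => p b ^+ 2 * q b ^+ 2) <= 3 * c * (P * Q).
  have h0 : 0 <= 3 * c * (P * Q) by do !apply: mulr_ge0 => //.
  rewrite -ler_sqr ?nnegrE //; apply: (le_trans cs); apply: (le_trans (ler_pM _ _ hP hQ)).
  - by apply: mean_ge0 => b; rewrite exprn_even_ge0.
  - by apply: mean_ge0 => b; rewrite exprn_even_ge0.
  - by rewrite le_eqVlt; apply/orP; left; apply/eqP; ring.
have PQ : 0 <= c * Q ^+ 2 by rewrite mulr_ge0 ?sqr_ge0.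
move: zle hP hQ; set z := mean _; set p4 := mean _; set q4 := mean _.
move=> zle hP hQ; rewrite sqrrD.
by have := ler_wpM2l (ler0n R 6) zle; lra.
Qed.

(** Powers of two suffice, since they are reached by applying [bonami] to
    F^(2^k), which has degree 2^k d. *)
Lemma high_moment (R : realFieldType) d k :
  exists2 c : R, 1 <= c & forall n (F : 'cV[bool]_n -> R), lowdeg d F ->
    mean (fun b => F b ^+ (2 ^ k.+1)) <= c * mean (fun b => F b ^+ 2) ^+ (2 ^ k).
Proof.
elim: k => [|k [c c1 IH]].
  by exists 1 => // n F _; rewrite expn0 expn1 expr1 mul1r.
exists (9 ^+ (2 ^ k.+1 * d) * (c ^+ 2)) => [|n F dF].
  by rewrite mulr_ege1 // exprn_ege1 // ler1n.
have h := bonami (lowdegX (2 ^ k) dF).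
have e (a b : nat) : mean (fun u => (F u ^+ a) ^+ b) = mean (fun u => F u ^+ (a * b)).
  by apply: eq_mean => u; rewrite exprM.
rewrite !e in h.
have -> : (2 ^ k.+2 = 2 ^ k * 4)%N by rewrite !expnS; lia.
apply: (le_trans h); rewrite -mulrA.
apply: ler_pM; rewrite ?exprn_ge0 ?sqr_ge0 //.
  by apply: mean_ge0 => b; rewrite exprM sqr_ge0.
  by rewrite ler_weXn2l ?ler1n // leq_mul2r expnS; lia.
have -> : (2 ^ k * 2 = 2 ^ k.+1)%N by rewrite expnS; lia.
have -> : (2 ^ k.+1 = 2 ^ k * 2)%N by rewrite expnS; lia.
rewrite exprM -exprMn; apply: lerXn2r; rewrite ?nnegrE.
- by apply: mean_ge0 => b; rewrite exprM sqr_ge0.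
- apply: mulr_ge0; first exact: le_trans ler01 c1.
  by apply/exprn_ge0/mean_ge0 => b; exact: sqr_ge0.
- have -> : (2 ^ k * 2 = 2 ^ k.+1)%N by rewrite expnS; lia.
  exact: IH.
Qed.

(** * The Poincare inequality and moments of sign sums *)

Definition flipb n (j : 'I_n) (b : 'cV[bool]_n) : 'cV[bool]_n :=
  \col_k (if k == j then ~~ b k 0 else b k 0).

Lemma flipb_consb0 n c (b : 'cV[bool]_n) : flipb ord0 (consb c b) = consb (~~ c) b.
Proof.
apply/matrixP => i k; rewrite (ord1 k) mxE.
case: (unliftP ord0 i) => [j ->|->]; last by rewrite eqxx !consb0.
by rewrite !consbS -(inj_eq val_inj).
Qed.

Lemma flipb_consbS n c (b : 'cV[bool]_n) j :
  flipb (lift ord0 j) (consb c b) = consb c (flipb j b).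
Proof.
apply/matrixP => i k; rewrite (ord1 k) mxE.
case: (unliftP ord0 i) => [l ->|->]; last by rewrite !consb0.
by rewrite !consbS mxE (inj_eq lift_inj).
Qed.

Lemma mean_sqr_le (R : realFieldType) n (F : 'cV[bool]_n -> R) :
  mean F ^+ 2 <= mean (fun b => F b ^+ 2).
Proof.
have := mean_cauchy_schwarz F (fun=> 1).
rewrite expr1n mean_cst mulr1; congr (_ ^+ 2 <= _).
by apply: eq_mean => b; rewrite mulr1.
Qed.

(** Conditioning on the first sign, the variance is the mean of the two
    conditional variances plus a quarter of the squared difference of the two
    conditional means; Jensen bounds the latter by the contribution of flipping
    the first sign. *)
Lemma poincare (R : realFieldType) n (F : 'cV[bool]_n -> R) :
  mean (fun b => F b ^+ 2) <= mean F ^+ 2 +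
    (\sum_j mean (fun b => (F b - F (flipb j b)) ^+ 2)) / 4.
Proof.
elim: n F => [|n IH] F.
  by rewrite big_ord0 mul0r addr0 !(mean_nil _ 0).
have h0 := IH (fun b => F (consb false b)).
have h1 := IH (fun b => F (consb true b)).
rewrite big_ord_recl !mean_consb.
have -> : \sum_(i < n) mean (fun b => (F b - F (flipb (lift ord0 i) b)) ^+ 2) =
  (\sum_i mean (fun b => (F (consb false b) - F (consb false (flipb i b))) ^+ 2)
  + \sum_i mean (fun b => (F (consb true b) - F (consb true (flipb i b))) ^+ 2)) / 2.
  rewrite -big_split /= mulr_suml; apply: eq_bigr => i _; rewrite mean_consb.
  by congr ((_ + _) / 2); apply: eq_mean => b; rewrite flipb_consbS.
have hd := mean_sqr_le (fun b => F (consb false b) + (-1) * F (consb true b)).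
rewrite meanD meanZ in hd.
have e (c : bool) : mean (fun b => (F (consb c b) - F (flipb ord0 (consb c b))) ^+ 2)
   = mean (fun b => (F (consb false b) + (-1) * F (consb true b)) ^+ 2).
  by apply: eq_mean => b; rewrite flipb_consb0; case: c => /=; ring.
rewrite !e.
move: h0 h1 hd.
set D := mean (fun b => (_ + _) ^+ 2).
set A := mean _; set B := mean _; set C := \sum_i _.
set A' := mean _; set B' := mean _; set C' := \sum_i _.
nra.
Qed.

Lemma mean_signsum2 (R : realFieldType) n (m : 'I_n -> R) :
  mean (fun b => signsum m b ^+ 2) = \sum_j m j ^+ 2.
Proof.
elim: n m => [|n IH] m.
  by rewrite big_ord0 (mean_nil _ 0) /signsum big_ord0 expr0n.
rewrite mean_consb big_ord_recl -IH; apply: canLR (mulfK _) _.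
  by rewrite pnatr_eq0.
rewrite -meanD [RHS]mulrC -[m ord0 ^+ 2](mean_cst n) -meanD -meanZ.
by apply: eq_mean => b; rewrite !signsum_consb; ring.
Qed.

Lemma mean_signsum4 (R : realFieldType) n (m : 'I_n -> R) :
  mean (fun b => signsum m b ^+ 4) =
  3 * (\sum_j m j ^+ 2) ^+ 2 - 2 * \sum_j m j ^+ 4.
Proof.
elim: n m => [|n IH] m.
  by rewrite !big_ord0 (mean_nil _ 0) /signsum big_ord0 !expr0n /= !mulr0 subr0.
rewrite mean_consb !big_ord_recl; set m' := fun j => m (lift ord0 j).
have -> : 3 * (m ord0 ^+ 2 + \sum_(i < n) m (lift ord0 i) ^+ 2) ^+ 2 -
   2 * (m ord0 ^+ 4 + \sum_(i < n) m (lift ord0 i) ^+ 4) =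
  mean (fun b => signsum m' b ^+ 4) +
  (6 * m ord0 ^+ 2) * mean (fun b => signsum m' b ^+ 2) + m ord0 ^+ 4.
  by rewrite IH mean_signsum2 /m'; ring.
apply: canLR (mulfK _) _; first by rewrite pnatr_eq0.
rewrite -meanZ -[m ord0 ^+ 4](mean_cst n) -!meanD [RHS]mulrC -meanZ.
by apply: eq_mean => b; rewrite !signsum_consb -/m' expr0 expr1; ring.
Qed.

Lemma orth_cols (R : realFieldType) n (M : 'M[R]_n) : M^T *m M = 1%:M ->
  forall j k, \sum_i M i j * M i k = (j == k)%:R.
Proof.
move=> h j k; have := congr1 (fun A : 'M[R]_n => A j k) h.
by rewrite !mxE => <-; apply: eq_bigr => i _; rewrite mxE.
Qed.

Lemma orth_rows (R : realFieldType) n (M : 'M[R]_n) : M^T *m M = 1%:M ->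
  forall i k, \sum_j M i j * M k j = (i == k)%:R.
Proof.
move=> /mulmx1C h i k; have := congr1 (fun A : 'M[R]_n => A i k) h.
by rewrite !mxE => <-; apply: eq_bigr => j _; rewrite mxE.
Qed.

Lemma orth_col_norm (R : realFieldType) n (M : 'M[R]_n) : M^T *m M = 1%:M ->
  forall j, \sum_i M i j ^+ 2 = 1.
Proof.
move=> h j; have := orth_cols h j j; rewrite eqxx => e; rewrite -[RHS]e.
by apply: eq_bigr => i _; rewrite expr2.
Qed.

Lemma orth_row_norm (R : realFieldType) n (M : 'M[R]_n) : M^T *m M = 1%:M ->
  forall i, \sum_j M i j ^+ 2 = 1.
Proof.
move=> h j; have := orth_rows h j j; rewrite eqxx => e; rewrite -[RHS]e.
by apply: eq_bigr => i _; rewrite expr2.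
Qed.

(** The norm of [M^T y] is that of y, since M^T is orthogonal too. *)
Lemma orth_isometry (R : realFieldType) n (M : 'M[R]_n) : M^T *m M = 1%:M ->
  forall y : 'I_n -> R, \sum_j (\sum_i y i * M i j) ^+ 2 = \sum_i y i ^+ 2.
Proof.
move=> h y.
under eq_bigr do rewrite expr2 big_distrlr /=.
rewrite exchange_big /=; apply: eq_bigr => i _.
rewrite exchange_big /= (bigD1 i) //= [X in _ + X]big1 => [|k ki].
  rewrite addr0 -[RHS]mulr1 -(orth_row_norm h i) mulr_sumr.
  by apply: eq_bigr => j _; ring.
transitivity (y i * y k * \sum_j M i j * M k j).
  by rewrite mulr_sumr; apply: eq_bigr => j _; ring.
by rewrite (orth_rows h) eq_sym (negPf ki) mulr0.
Qed.

Definition row_spread (R : realFieldType) n (m : 'I_n -> R) : R :=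
  1 - \sum_j m j ^+ 4.

Definition off (R : realFieldType) n (m : 'I_n -> R) (j : 'I_n) : 'I_n -> R :=
  fun k => if k == j then 0 else m k.

Lemma signsum_off (R : realFieldType) n (m : 'I_n -> R) j b :
  signsum (off m j) b = signsum m b - m j * (-1) ^+ b j 0.
Proof.
rewrite /signsum (bigD1 j) //= [in RHS](bigD1 j) //= /off eqxx mul0r add0r.
rewrite addrAC subrr add0r; apply: eq_bigr => k kj.
by rewrite (negPf kj).
Qed.

Lemma off_norm (R : realFieldType) n (m : 'I_n -> R) j :
  \sum_k m k ^+ 2 = 1 -> \sum_k off m j k ^+ 2 = 1 - m j ^+ 2.
Proof.
move=> <-; rewrite (bigD1 j) //= [in RHS](bigD1 j) //= /off eqxx expr0n add0r.
rewrite addrAC subrr add0r; apply: eq_bigr => k kj.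
by rewrite (negPf kj).
Qed.

Lemma signsum_flipb (R : realFieldType) n (m : 'I_n -> R) j b :
  signsum m (flipb j b) = signsum m b - 2 * (m j * (-1) ^+ b j 0).
Proof.
have e : signsum (off m j) (flipb j b) = signsum (off m j) b.
  apply: eq_bigr => k _; rewrite /off mxE; case: eqP => // _.
  by rewrite !mul0r.
move/eqP: e; rewrite !signsum_off mxE eqxx subr_eq => /eqP ->.
by rewrite signrN; move: ((-1) ^+ _) => y; ring.
Qed.

(** * The quartic energy of an orthogonal matrix *)

Definition quartic (R : realFieldType) n (M : 'M[R]_n) (b : 'cV[bool]_n) : R :=
  \sum_i signsum (M i) b ^+ 4.

Definition spread (R : realFieldType) n (M : 'M[R]_n) : R :=
  \sum_i row_spread (M i).

Lemma sum_weighted_sqr_le (R : realFieldType) (I : finType) (m y : I -> R) :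
  \sum_i m i ^+ 2 = 1 ->
  (\sum_i y i * m i ^+ 2) ^+ 2 <= \sum_i m i ^+ 2 * y i ^+ 2.
Proof.
move=> h; have := cauchy_schwarz_sum (index_enum I) xpredT m (fun i => m i * y i).
rewrite h mul1r; congr (_ ^+ 2 <= _).
  by apply: eq_bigr => i _; ring.
by apply: eq_bigr => i _; ring.
Qed.

(** With x the flipped sign and a_i = M_ij x, the sums of the f_i a_i and of the
    a_i^2 are both 1.  Subtracting 8 times their difference from the variation
    of the quartic energy turns each term f_i^4 - (f_i - 2 a_i)^4 into
    8 f_i g_i a_i - 8 g_i a_i^2 - 16 a_i^2 (f_i - a_i)^2, and each of the three
    resulting sums is small when the rows are close to signed unit vectors.  The
    a_i^2 being weights of total mass 1, Jensen handles the last two. *)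
Lemma quartic_flipb (R : realFieldType) n (M : 'M[R]_n) b j
    (f := fun i => signsum (M i) b) (g := fun i => f i ^+ 2 - 1) :
  M^T *m M = 1%:M ->
  (quartic M b - quartic M (flipb j b)) ^+ 2 <= 192 *
    ((\sum_i f i * g i * M i j) ^+ 2 + \sum_i M i j ^+ 2 * g i ^+ 2 +
     4 * \sum_i M i j ^+ 2 * (signsum (off (M i) j) b) ^+ 4).
Proof.
move=> oM.
pose x : R := (-1) ^+ b j 0.
have x2 : x ^+ 2 = 1 by rewrite sqrr_sign.
have colj := orth_col_norm oM j.
have hfx : \sum_i f i * M i j = x.
  rewrite /f /signsum.
  under eq_bigr do rewrite mulr_suml.
  rewrite exchange_big /= (bigD1 j) //= [X in _ + X]big1 => [|k kj].
    rewrite addr0; transitivity (x * \sum_i M i j ^+ 2); last by rewrite colj mulr1.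
    by rewrite mulr_sumr; apply: eq_bigr => i _; rewrite -/x; ring.
  transitivity ((-1) ^+ b k 0 * \sum_i M i k * M i j).
    by rewrite mulr_sumr; apply: eq_bigr => i _; ring.
  by rewrite (orth_cols oM) (negPf kj) mulr0.
pose u := \sum_i f i * g i * M i j.
pose v := \sum_i g i * M i j ^+ 2.
pose h i := signsum (off (M i) j) b.
pose w := \sum_i h i ^+ 2 * M i j ^+ 2.
have -> : quartic M b - quartic M (flipb j b) = 8 * (x * u) - 8 * v - 16 * w.
  rewrite -[LHS]subr0.
  (* The vanishing correction that brings out the factors g. *)
  have -> : (0 : R) = 8 * (x * (\sum_i f i * M i j) - \sum_i M i j ^+ 2).
    by rewrite hfx colj -expr2 x2 subrr mulr0.
  rewrite /quartic /u /v /w !mulr_sumr -!sumrB mulr_sumr -sumrB.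
  apply: eq_bigr => i _; rewrite signsum_flipb -/x /h signsum_off -/x.
  by rewrite -/(f i) /g /x; case: (b j 0); rewrite ?expr0 ?expr1; ring.
have xu : (x * u) ^+ 2 = u ^+ 2 by rewrite exprMn x2 mul1r.
have hv : v ^+ 2 <= \sum_i M i j ^+ 2 * g i ^+ 2 by exact: sum_weighted_sqr_le.
have hw : w ^+ 2 <= \sum_i M i j ^+ 2 * h i ^+ 4.
  under eq_bigr do rewrite (exprM _ 2 2).
  exact: sum_weighted_sqr_le.
rewrite -/u -xu -/h; move: hv hw.
set y := x * u; set V := \sum_i _; set W := \sum_i _ => hv hw.
have h1 := sqr_ge0 (y + v); have h2 := sqr_ge0 (y + 2 * w).
have h3 := sqr_ge0 (v - 2 * w).
nra.
Qed.

Lemma mean_quartic (R : realFieldType) n (M : 'M[R]_n) :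
  M^T *m M = 1%:M -> mean (quartic M) = n%:R + 2 * spread M.
Proof.
move=> oM; rewrite /quartic mean_sum /spread mulr_sumr.
rewrite -[n in n%:R]card_ord -sum1_card natr_sum -big_split.
apply: eq_bigr => i _; rewrite mean_signsum4 (orth_row_norm oM) /row_spread /=.
by ring.
Qed.

(** Summing the bound of [quartic_flipb] over j, the first sum becomes
    the sum of f_i^2 g_i^2 because M is an isometry, and the second that of
    g_i^2, whose mean is twice the spread of row i.  Hypercontractivity bounds
    the other two contributions by multiples of the total spread as well. *)
Lemma quartic_variance (R : realFieldType) n (M : 'M[R]_n) :
  M^T *m M = 1%:M ->
  mean (fun b => (quartic M b - mean (quartic M)) ^+ 2) <= 4416 * spread M.
Proof.
move=> oM.
set mu := mean (quartic M).
have e0 : mean (fun b => quartic M b - mu) = 0.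
  by rewrite meanD mean_cst subrr.
have := poincare (fun b => quartic M b - mu).
rewrite e0 expr0n add0r => /le_trans; apply.
rewrite ler_pdivrMr // -[4416 * _ * 4]/(4416 * spread M * 4).
pose f i b := signsum (M i) b.
pose g i b := f i b ^+ 2 - 1.
pose h i j b := signsum (off (M i) j) b.
have step : \sum_j mean (fun b => (quartic M b - mu - (quartic M (flipb j b) - mu)) ^+ 2)
   <= 192 * (mean (fun b => \sum_i (f i b * g i b) ^+ 2)
   + mean (fun b => \sum_i g i b ^+ 2)
   + 4 * \sum_i \sum_j M i j ^+ 2 * mean (fun b => h i j b ^+ 4)).
  have -> : mean (fun b => \sum_i (f i b * g i b) ^+ 2) =
     \sum_j mean (fun b => (\sum_i f i b * g i b * M i j) ^+ 2).
    rewrite -mean_sum; apply: eq_mean => b.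
    by rewrite (orth_isometry oM (fun i => f i b * g i b)).
  have -> : mean (fun b => \sum_i g i b ^+ 2) =
     \sum_j mean (fun b => \sum_i M i j ^+ 2 * g i b ^+ 2).
    rewrite -mean_sum; apply: eq_mean => b.
    rewrite exchange_big /=; apply: eq_bigr => i _.
    by rewrite -mulr_suml (orth_row_norm oM) mul1r.
  rewrite exchange_big /= [4 * _]mulr_sumr -!big_split /= mulr_sumr.
  apply: ler_sum => j _.
  have -> : \sum_i M i j ^+ 2 * mean (fun b => h i j b ^+ 4) =
     mean (fun b => \sum_i M i j ^+ 2 * h i j b ^+ 4).
    by rewrite mean_sum; apply: eq_bigr => i _; rewrite meanZ.
  rewrite -meanZ -!meanD -meanZ; apply: ler_mean => b.
  rewrite [X in X ^+ 2 <= _](_ : _ = quartic M b - quartic M (flipb j b)).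
    exact: (quartic_flipb b j oM).
  by ring.
apply: (le_trans step); rewrite {step}.
have mg i : mean (fun b => g i b ^+ 2) = 2 * row_spread (M i).
  have : mean (fun b => g i b ^+ 2) =
     mean (fun b => f i b ^+ 4 + (- 2) * f i b ^+ 2 + 1).
    by apply: eq_mean => b; rewrite /g; ring.
  rewrite !meanD meanZ mean_cst mean_signsum2 mean_signsum4 => ->.
  by rewrite (orth_row_norm oM) /row_spread; ring.
have dg i : lowdeg 2 (g i).
  apply: lowdegD; last exact: lowdeg_cst.
  by have := lowdegX 2 (lowdeg_signsum (M i)); rewrite muln1.
have mfg i : mean (fun b => (f i b * g i b) ^+ 2) <= 27 * mean (fun b => g i b ^+ 2).
  have G0 : 0 <= mean (fun b => g i b ^+ 2).
    by apply: mean_ge0 => b; exact: sqr_ge0.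
  have F0 : 0 <= mean (fun b => (f i b * g i b) ^+ 2).
    by apply: mean_ge0 => b; exact: sqr_ge0.
  rewrite -ler_sqr ?nnegrE //; last exact: mulr_ge0 (ler0n _ _) G0.
  have := mean_cauchy_schwarz (fun b => f i b ^+ 2) (fun b => g i b ^+ 2).
  have -> : mean (fun b => f i b ^+ 2 * g i b ^+ 2) = mean (fun b => (f i b * g i b) ^+ 2).
    by apply: eq_mean => b; rewrite exprMn.
  move=> /le_trans; apply.
  have -> : mean (fun b => (f i b ^+ 2) ^+ 2) = mean (fun b => f i b ^+ 4).
    by apply: eq_mean => b; rewrite -exprM.
  have -> : mean (fun b => (g i b ^+ 2) ^+ 2) = mean (fun b => g i b ^+ 4).
    by apply: eq_mean => b; rewrite -exprM.
  have h1 := bonami (lowdeg_signsum (M i)).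
  rewrite mean_signsum2 (orth_row_norm oM) expr1n mulr1 expr1 in h1.
  have h2 := bonami (dg i).
  apply: (le_trans (ler_pM _ _ h1 h2)).
  - by apply: mean_ge0 => b; rewrite exprn_even_ge0.
  - by apply: mean_ge0 => b; rewrite exprn_even_ge0.
  by rewrite le_eqVlt; apply/orP; left; apply/eqP; ring.
have mh i j : mean (fun b => h i j b ^+ 4) <= 9 * (1 - M i j ^+ 2).
  have := bonami (lowdeg_signsum (off (M i) j)).
  rewrite mean_signsum2 off_norm ?(orth_row_norm oM) // expr1 => /le_trans; apply.
  have h0 : 0 <= 1 - M i j ^+ 2.
    rewrite -off_norm ?(orth_row_norm oM) //.
    by apply: sumr_ge0 => k _; exact: sqr_ge0.
  have h1 := sqr_ge0 (M i j).
  by rewrite ler_pM2l // -[leRHS]mul1r expr2 ler_wpM2r // lerBlDr lerDl.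
have b1 : mean (fun b => \sum_i g i b ^+ 2) = 2 * spread M.
  by rewrite mean_sum /spread mulr_sumr; apply: eq_bigr => i _.
have b2 : mean (fun b => \sum_i (f i b * g i b) ^+ 2) <= 54 * spread M.
  rewrite mean_sum /spread mulr_sumr; apply: ler_sum => i _.
  by have := mfg i; rewrite mg mulrA -natrM.
have b3 : \sum_i \sum_j M i j ^+ 2 * mean (fun b => h i j b ^+ 4) <= 9 * spread M.
  rewrite /spread mulr_sumr; apply: ler_sum => i _.
  rewrite [row_spread _](_ : _ = \sum_j (M i j ^+ 2 - M i j ^+ 4)); last first.
    by rewrite sumrB (orth_row_norm oM).
  rewrite mulr_sumr.
  apply: ler_sum => j _.
  have := ler_wpM2l (sqr_ge0 (M i j)) (mh i j).
  by move=> /le_trans; apply; rewrite le_eqVlt; apply/orP; left; apply/eqP; ring.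
rewrite b1; lra.
Qed.

Lemma row_spread_ge (R : realFieldType) n (m : 'I_n -> R) (a : R) :
  \sum_j m j ^+ 2 = 1 -> (forall j, m j ^+ 2 <= a) -> 1 - a <= row_spread m.
Proof.
move=> h ha; rewrite /row_spread lerD2l lerN2.
rewrite -[leRHS]mulr1 -h mulr_sumr; apply: ler_sum => j _.
by rewrite (exprM _ 2 2) [X in X <= _]expr2 ler_wpM2r // sqr_ge0.
Qed.

Lemma row_spread_ge0 (R : realFieldType) n (m : 'I_n -> R) :
  \sum_j m j ^+ 2 = 1 -> 0 <= row_spread m.
Proof.
move=> h; rewrite -[0](subrr 1); apply: row_spread_ge => // j.
by rewrite -h (bigD1 j) //= lerDl; apply: sumr_ge0 => k _; exact: sqr_ge0.
Qed.

(** On P the quartic energy is 2 S below its mean, where S is the spread.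
    Markov's inequality for the moment of order 2 q, q = 2^D, hence gives
    t^-D (2 S)^(2 q) <= c (v S)^q, with v the constant of
    [quartic_variance], and as t^D <= t^q the q-th root
    yields S = O(t). *)
Lemma spread_bound (R : realFieldType) (D : nat) :
  exists2 c : R, 1 <= c & forall n (M : 'M[R]_n) (P : pred 'cV[bool]_n) (t : R),
    M^T *m M = 1%:M -> 1 <= t ->
    (forall b, P b -> quartic M b = n%:R) ->
    t ^- D <= mean (fun b => (P b)%:R) -> spread M <= c * t.
Proof.
have [c0 c01 hm] := high_moment R 4 D.
have [v v4 hv] : exists2 v : R, 4 <= v & forall n (M : 'M[R]_n), M^T *m M = 1%:M ->
    mean (fun b => (quartic M b - mean (quartic M)) ^+ 2) <= v * spread M.
  by exists 4416; [rewrite ler_nat | exact: quartic_variance].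
have v0 : 0 < v by exact: lt_le_trans v4.
exists (v / 4 * c0) => [|n M P t oM t1 hP tP].
  by rewrite mulr_ege1 // ler_pdivlMr // mul1r.
set S := spread M.
have S0 : 0 <= S.
  by apply: sumr_ge0 => i _; apply: row_spread_ge0; exact: orth_row_norm.
have t0 : 0 < t by exact: lt_le_trans t1.
have c00 : 0 < c0 by exact: lt_le_trans c01.
have dH : lowdeg 4 (fun b => quartic M b - mean (quartic M)).
  apply: lowdegD; last exact: lowdeg_cst.
  apply: lowdeg_sum => i.
  by have := lowdegX 4 (lowdeg_signsum (M i)); rewrite muln1.
have h1 := hm _ _ dH; have h2 := hv _ _ oM.
rewrite -/S in h2; set q := (2 ^ D)%N in h1 hm.
have q0 : (0 < q)%N by rewrite expn_gt0.
have Dq : (D <= q)%N by rewrite ltnW // ltn_expl.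
have V0 : 0 <= mean (fun b => (quartic M b - mean (quartic M)) ^+ 2).
  by apply: mean_ge0 => b; exact: sqr_ge0.
have h3 : mean (fun b => (P b)%:R) * (2 * S) ^+ (2 ^ D.+1) <=
    mean (fun b => (quartic M b - mean (quartic M)) ^+ (2 ^ D.+1)).
  rewrite mulrC -meanZ; apply: ler_mean => b.
  case Pb: (P b); last first.
    by rewrite mulr0 expnS exprM exprn_ge0 // sqr_ge0.
  rewrite mulr1 (hP b Pb) mean_quartic // -/S opprD addrA subrr add0r.
  by rewrite expnS !(exprM _ 2 (2 ^ D)) sqrrN.
have h4 : (4 * S ^+ 2) ^+ q <= (c0 * t * (v * S)) ^+ q.
  have -> : 4 * S ^+ 2 = (2 * S) ^+ 2 by ring.
  rewrite -exprM -expnS.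
  have e1 : t ^- D * (2 * S) ^+ (2 ^ D.+1) <= c0 * (v * S) ^+ q.
    apply: (@le_trans _ _ (mean (fun b => (P b)%:R) * (2 * S) ^+ (2 ^ D.+1))).
      by apply: ler_wpM2r => //; rewrite exprn_ge0 // mulr_ge0.
    apply: (le_trans h3); apply: (le_trans h1).
    rewrite (ler_pM2l c00); apply: lerXn2r => //; rewrite nnegrE.
    by rewrite mulr_ge0 // ltW.
  rewrite mulrC ler_pdivrMr ?exprn_gt0 // in e1.
  apply: (le_trans e1); rewrite [leRHS]exprMn mulrAC; apply: ler_wpM2r.
    by rewrite exprn_ge0 // mulr_ge0 // ltW.
  rewrite exprMn; apply: ler_pM; rewrite ?exprn_ge0 ?(ltW t0) ?(ltW c00) //.
    by rewrite -[leLHS]expr1 ler_weXn2l.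
  by rewrite ler_weXn2l.
move: h4; rewrite ler_pXn2r ?nnegrE //; last 2 first.
- by rewrite mulr_ge0 // sqr_ge0.
- by rewrite !mulr_ge0 // ltW.
move: S0; rewrite le_eqVlt => /orP[/eqP <- _|S0].
  by rewrite ltW // !mulr_gt0 // invr_gt0.
move=> h5.
have e : 4 * (v / 4 * c0 * t * S) = c0 * t * (v * S) by field.
by move: h5; rewrite -e ler_pM2l // expr2 ler_pM2r.
Qed.

(** Markov's inequality for a high moment, bounded by hypercontractivity for
    degree 1. *)
Lemma tail_bound (R : realFieldType) (D : nat) :
  exists2 c : R, 1 <= c & forall n (m : 'I_n -> R) (t : R),
    0 < t -> \sum_j m j ^+ 2 <= t^-1 ->
    mean (fun b => (1 <= `|signsum m b|)%R%:R) <= c / t ^+ (2 ^ D).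
Proof.
have [c c1 hc] := high_moment R 1 D.
exists c => // n m t t0 hm.
apply: (@le_trans _ _ (mean (fun b => signsum m b ^+ (2 ^ D.+1)))).
  apply: ler_mean => b; case: (lerP 1 `|signsum m b|) => h.
    rewrite expnS exprM -real_normK ?num_real // -exprM.
    by rewrite exprn_ege1.
  by rewrite expnS exprM exprn_ge0 // sqr_ge0.
apply: (le_trans (hc _ _ (lowdeg_signsum m))).
rewrite ler_pM2l ?(lt_le_trans ltr01) // mean_signsum2 -exprVn.
apply: lerXn2r; rewrite ?nnegrE ?invr_ge0 ?(ltW t0) //.
by apply: sumr_ge0 => j _; exact: sqr_ge0.
Qed.

(** * A Halasz inequality for sign combinations of vectors *)

(** The multiset of all sums of c_a a, over a in l, with coefficients c_a taken
    from sg: normalised, the law of a combination of l with independent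
    coefficients uniform in sg. *)
Definition combos (R : nzRingType) (V : lmodType R) (sg : seq R) (l : seq V) : seq V :=
  foldr (fun a s => [seq c *: a + v | c <- sg, v <- s]) [:: 0] l.

Lemma sum_combos_cons (R : nzRingType) (V : lmodType R) (W : nmodType)
    sg (a : V) l (phi : V -> W) :
  \sum_(u <- combos sg (a :: l)) phi u =
  \sum_(c <- sg) \sum_(u <- combos sg l) phi (c *: a + u).
Proof. by rewrite /= big_allpairs_dep. Qed.

Lemma sum_combos_cat (R : nzRingType) (V : lmodType R) (W : nmodType)
    sg (l1 l2 : seq V) (phi : V -> W) :
  \sum_(u <- combos sg (l1 ++ l2)) phi u =
  \sum_(u <- combos sg l1) \sum_(v <- combos sg l2) phi (u + v).
Proof.
elim: l1 phi => [|a l1 IH] phi.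
  by rewrite /= big_seq1; apply: eq_bigr => v _; rewrite add0r.
rewrite cat_cons !sum_combos_cons; apply: eq_bigr => c _.
rewrite IH; apply: eq_bigr => u _; apply: eq_bigr => v _.
by rewrite addrA.
Qed.

Lemma sum_combos_perm (R : nzRingType) (V : lmodType R) (W : nmodType)
    sg (l1 l2 : seq V) (phi : V -> W) : perm_eq l1 l2 ->
  \sum_(u <- combos sg l1) phi u = \sum_(u <- combos sg l2) phi u.
Proof.
pose F l := \sum_(u <- combos sg l) phi u.
move: l1 l2; apply: (catCA_perm_subst (F := F)) => s1 s2 s3.
have e l1 l2 l3 : F (l1 ++ l2 ++ l3) = \sum_(u <- combos sg l1)
    \sum_(v <- combos sg l2) \sum_(w <- combos sg l3) phi (u + (v + w)).
  rewrite /F sum_combos_cat; apply: eq_bigr => u _.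
  exact: (sum_combos_cat sg l2 l3 (fun w => phi (u + w))).
rewrite !e exchange_big /=; apply: eq_bigr => u _; apply: eq_bigr => v _.
by apply: eq_bigr => w _; rewrite addrCA.
Qed.

Definition diffs (R : nzRingType) (sg : seq R) : seq R :=
  [seq c - d | c <- sg, d <- sg].

(** The difference of two independent copies of a random combination is a
    combination with coefficients distributed as the difference of two
    independent coefficients. *)
Lemma sum_combos_sub (R : comNzRingType) (V : lmodType R) (W : nmodType)
    sg (l : seq V) (phi : V -> W) :
  \sum_(u <- combos sg l) \sum_(v <- combos sg l) phi (u - v) =
  \sum_(w <- combos (diffs sg) l) phi w.
Proof.
elim: l phi => [|a l IH] phi; first by rewrite /= !big_seq1 subr0.
rewrite !sum_combos_cons big_allpairs_dep; apply: eq_bigr => c _.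
rewrite (eq_bigr (fun u => \sum_(d <- sg) \sum_(v <- combos sg l)
   phi (c *: a + u - (d *: a + v)))) => [|u _]; last first.
  exact: (sum_combos_cons sg a l (fun v => phi (c *: a + u - v))).
rewrite exchange_big /=; apply: eq_bigr => d _.
rewrite -(IH (fun w => phi ((c - d) *: a + w))).
apply: eq_bigr => u _; apply: eq_bigr => v _; congr phi.
by rewrite scalerBl opprD addrACA.
Qed.

Definition hits (R : realFieldType) (V : lmodType R) (sg : seq R) (l : seq V) (v : V) : R :=
  \sum_(u <- combos sg l) (u == v)%:R.

Lemma hits_ge0 (R : realFieldType) (V : lmodType R) sg (l : seq V) v : 0 <= hits sg l v.
Proof. by apply: sumr_ge0 => u _; rewrite ler0n. Qed.

(** P(X + Y = v) is the sum over a of P(X = a) P(Y = v - a), and the sum of the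
    P(X = a)^2 is the collision probability of two copies of X. *)
Lemma collision_cauchy_schwarz (R : realFieldType) (V : zmodType) (s t : seq V) v :
  (\sum_(a <- s) \sum_(b <- t) (a + b == v)%:R) ^+ 2 <=
  (\sum_(a <- s) \sum_(b <- s) (a - b == 0)%:R) *
  (\sum_(a <- t) \sum_(b <- t) (a - b == 0)%:R) :> R.
Proof.
pose p a : R := \sum_(b <- s) (a - b == 0)%:R.
pose q a : R := \sum_(b <- t) (a + b == v)%:R.
have split (f : V -> R) : \sum_(a <- s) f a = \sum_(a <- undup s) p a * f a.
  rewrite /p; under [RHS]eq_bigr do rewrite mulr_suml.
  rewrite exchange_big /=; apply: eq_big_seq => a sa.
  rewrite (bigD1_seq a) ?mem_undup ?undup_uniq //= subrr eqxx mul1r.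
  rewrite big1 ?addr0 // => b ba.
  by rewrite subr_eq0 (negPf ba) mul0r.
rewrite split; apply: (le_trans (cauchy_schwarz_sum _ _ _ _)).
apply: ler_pM; try by apply: sumr_ge0 => a _; rewrite sqr_ge0.
  by rewrite split; apply: ler_sum => a _; rewrite expr2.
rewrite /q; under eq_bigr do rewrite expr2 big_distrlr /=.
rewrite exchange_big /=; apply: ler_sum => b _.
rewrite exchange_big /=; apply: ler_sum => b' _.
case: (eqVneq (b - b') 0) => [|bb'].
  move=> _; apply: (@le_trans _ _ (\sum_(a <- undup s) (a == v - b)%:R)).
    apply: ler_sum => a _; rewrite -(inj_eq (addIr b)) subrK.
    by case: eqP => _; case: eqP => _; rewrite ?mulr0 ?mul0r ?mulr1 ?ler01.
  case: (boolP (v - b \in undup s)) => [vs|vs].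
    rewrite (bigD1_seq (v - b)) ?undup_uniq //= eqxx big1 ?addr0 // => a ab.
    by rewrite (negPf ab).
  rewrite big_seq big1 ?ler01 // => a sa.
  by case: eqP sa vs => // -> ->.
rewrite big1 // => a _; case: eqP => [e|]; last by rewrite mul0r.
case: eqP => [e'|]; last by rewrite mulr0.
by move: bb'; rewrite -e' in e; rewrite (addrI _ e) subrr eqxx.
Qed.

Lemma hits_cat_le (R : realFieldType) (V : lmodType R) sg (l1 l2 : seq V) v :
  hits sg (l1 ++ l2) v ^+ 2 <= hits (diffs sg) l1 0 * hits (diffs sg) l2 0.
Proof.
rewrite /hits sum_combos_cat -!sum_combos_sub.
exact: collision_cauchy_schwarz.
Qed.

(** Repeated Cauchy-Schwarz plays the role of Hoelder's inequality for the
    characteristic functions of the blocks: it decouples 2^(k+1) blocks, at the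
    price of replacing each coefficient by an alternating sum of 2^(k+1)
    independent copies. *)
Lemma hits_flatten_le (R : realFieldType) (V : lmodType R) k sg (bs : seq (seq V)) v :
  size bs = (2 ^ k.+1)%N ->
  hits sg (flatten bs) v ^+ (2 ^ k.+1) <=
  \prod_(B <- bs) hits (iter k.+1 (@diffs R) sg) B 0.
Proof.
elim: k sg bs v => [|k IH] sg bs v.
  case: bs => [|b1 [|b2 [|]]] //= _.
  by rewrite cats0 !big_cons big_nil mulr1 expn1 hits_cat_le.
move=> sz; rewrite -(cat_take_drop (2 ^ k.+1) bs) flatten_cat big_cat.
have s1 : size (take (2 ^ k.+1) bs) = (2 ^ k.+1)%N.
  by rewrite size_takel // sz leq_exp2l.
have s2 : size (drop (2 ^ k.+1) bs) = (2 ^ k.+1)%N.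
  by rewrite size_drop sz [in LHS](expnS _ k.+1) mul2n -addnn addnK.
rewrite (expnS 2 k.+1) exprM.
apply: (@le_trans _ _ ((hits (diffs sg) (flatten (take (2 ^ k.+1) bs)) 0 *
  hits (diffs sg) (flatten (drop (2 ^ k.+1) bs)) 0) ^+ (2 ^ k.+1))).
  apply: lerXn2r; rewrite ?nnegrE ?sqr_ge0 ?mulr_ge0 ?hits_ge0 //.
  exact: hits_cat_le.
rewrite exprMn; apply: ler_pM; rewrite ?exprn_ge0 ?hits_ge0 //.
  by rewrite iterSr; exact: IH s1.
by rewrite iterSr; exact: IH s2.
Qed.

Lemma combos_lin (R : realFieldType) (V : lmodType R) sg r (v : 'I_r -> V) u :
  u \in combos sg [seq v j | j <- enum 'I_r] ->
  exists c : 'I_r -> R, u = \sum_j c j *: v j.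
Proof.
elim: r v u => [|r IH] v u.
  rewrite (_ : enum 'I_0 = [::]); last by apply/eqP; rewrite -size_eq0 size_enum_ord.
  by rewrite inE => /eqP ->; exists (fun=> 0); rewrite big_ord0.
rewrite enum_ordSl map_cons -map_comp /= => /allpairsP[[c u'] /= [_ h ->]].
have [d ->] := IH (v \o lift ord0) u' h.
exists (fun j => if unlift ord0 j is Some j' then d j' else c).
rewrite big_ord_recl unlift_none; congr (_ + _).
by apply: eq_bigr => j _; rewrite liftK.
Qed.

Definition zeros (R : realFieldType) (sg : seq R) : R := \sum_(c <- sg) (c == 0)%:R.

(** A combination of independent vectors vanishes only if each coefficient
    does. *)
Lemma hits_indep (R : realFieldType) (V : lmodType R) sg r (v : 'I_r -> V) :
  (forall c : 'I_r -> R, \sum_j c j *: v j = 0 -> forall j, c j = 0) ->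
  hits sg [seq v j | j <- enum 'I_r] 0 = zeros sg ^+ r.
Proof.
elim: r v => [|r IH] v hv.
  rewrite (_ : enum 'I_0 = [::]); last by apply/eqP; rewrite -size_eq0 size_enum_ord.
  by rewrite /hits big_seq1 eqxx.
rewrite enum_ordSl map_cons -map_comp /hits sum_combos_cons exprS /zeros mulr_suml.
apply: eq_bigr => c _; rewrite -(IH (v \o lift ord0)); last first.
  move=> d hd j.
  have := hv (fun j => if unlift ord0 j is Some j' then d j' else 0).
  rewrite big_ord_recl unlift_none scale0r add0r => h.
  suff /h/(_ (lift ord0 j)) : \sum_(i < r)
      (if unlift ord0 (lift ord0 i) is Some j' then d j' else 0) *:
      v (lift ord0 i) = 0 by rewrite liftK.
  by rewrite -[RHS]hd; apply: eq_bigr => i _; rewrite liftK.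
rewrite /hits mulr_sumr; apply: eq_big_seq => u hu.
rewrite -natrM mulnb; congr (nat_of_bool _)%:R.
apply/eqP/andP => [e|[/eqP -> /eqP ->]]; last by rewrite scale0r addr0.
have [d du] := combos_lin hu.
have h := hv (fun j => if unlift ord0 j is Some j' then d j' else c).
have {h} h : forall j, (if unlift ord0 j is Some j' then d j' else c) = 0.
  apply: h; rewrite big_ord_recl unlift_none -[RHS]e; congr (_ + _).
  by rewrite du; apply: eq_bigr => j _; rewrite liftK.
split; first by have := h ord0; rewrite unlift_none => ->.
rewrite du big1 // => j _.
by have := h (lift ord0 j); rewrite liftK => ->; rewrite scale0r.
Qed.

(** The sum of phi over the 2^N endpoints of the simple random walks of length
    N from 0. *)
Fixpoint walk (R : realFieldType) (N : nat) (phi : R -> R) : R :=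
  if N is N'.+1 then walk N' (fun x => phi (x + 1) + phi (x - 1)) else phi 0.

Lemma walk_binomial (R : realFieldType) N (phi : R -> R) :
  walk N phi = \sum_(i < N.+1) 'C(N, i)%:R * phi (2 * i%:R - N%:R).
Proof.
elim: N phi => [|N IH] phi.
  by rewrite big_ord_recl big_ord0 bin0 mulr0 subr0 mul1r addr0.
pose a i := 'C(N, i)%:R * phi (2 * i%:R - N%:R + 1).
pose b i := 'C(N, i)%:R * phi (2 * i%:R - N%:R - 1).
transitivity (\sum_(i < N.+1) a i + \sum_(i < N.+2) b i).
  rewrite /= IH [X in _ + X]big_ord_recr /= [b N.+1]/b bin_small // mul0r addr0.
  by rewrite -big_split; apply: eq_bigr => i _; rewrite mulrDr.
rewrite [X in _ + X]big_ord_recl [RHS]big_ord_recl addrCA -big_split.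
congr (_ + _).
  by rewrite /b !bin0; congr (_ * phi _); rewrite -natr1; ring.
apply: eq_bigr => i _; rewrite /a /b lift0 binS natrD [RHS]mulrDl [RHS]addrC /=.
by congr (_ * phi _ + _ * phi _); rewrite -!natr1; ring.
Qed.

Lemma eq_walk (R : realFieldType) N (phi psi : R -> R) :
  phi =1 psi -> walk N phi = walk N psi.
Proof. by move=> h; rewrite !walk_binomial; apply: eq_bigr => i _; rewrite h. Qed.

Lemma walkD (R : realFieldType) N (phi psi : R -> R) :
  walk N (fun x => phi x + psi x) = walk N phi + walk N psi.
Proof.
by rewrite !walk_binomial -big_split; apply: eq_bigr => i _; rewrite mulrDr.
Qed.

Lemma walk_opp (R : realFieldType) N (phi : R -> R) :
  walk N (fun x => phi (- x)) = walk N phi.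
Proof.
elim: N phi => [|N IH] phi /=; first by rewrite oppr0.
rewrite -[RHS]IH; apply: eq_walk => x.
by rewrite addrC; congr (phi _ + phi _); ring.
Qed.

Lemma walk_add (R : realFieldType) N N' (phi : R -> R) :
  walk (N + N') phi = walk N (fun x => walk N' (fun y => phi (x + y))).
Proof.
elim: N phi => [|N IH] phi; first by apply: eq_walk => x; rewrite add0r.
rewrite addSn /= IH; apply: eq_walk => x; rewrite -walkD.
by apply: eq_walk => y; congr (phi _ + phi _); ring.
Qed.

(** Iterated differences of signs are distributed as a simple random walk, whose
    steps are symmetric. *)
Lemma sum_iter_diffs (R : realFieldType) k (phi : R -> R) :
  \sum_(c <- iter k (@diffs R) [:: 1; -1]) phi c = walk (2 ^ k) phi.
Proof.
elim: k phi => [|k IH] phi; first by rewrite /= !big_cons big_nil addr0 add0r sub0r.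
rewrite iterS big_allpairs_dep.
under eq_bigr do rewrite (IH (fun d => phi (_ - d))).
rewrite IH expnS mul2n -addnn walk_add; apply: eq_walk => x.
by rewrite -[RHS]walk_opp.
Qed.

(** The factor 2 N + 1, rather than 2 N, makes the bound pass through the
    induction, as (2 N + 1) (2 N + 3) <= 4 (N + 1)^2. *)
Lemma central_binomial (N : nat) : ('C(N.*2, N) ^ 2 * N.*2.+1 <= 16 ^ N)%N.
Proof.
elim: N => [//|N IH].
have e : (N.+1 * 'C(N.+1.*2, N.+1) = 2 * (N.*2.+1 * 'C(N.*2, N)))%N.
  have h1 := mul_bin_diag N.+1.*2 N.
  have h2 := mul_bin_down N.*2.+1 N.
  rewrite -h1 doubleS /= h2 mulnA; congr (_ * _)%N; lia.
rewrite -(leq_pmul2l (m := N.+1 ^ 2)) ?expn_gt0 // mulnA -expnMn e.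
set c := 'C(N.*2, N) in IH *.
have -> : ((2 * (N.*2.+1 * c)) ^ 2 * N.+1.*2.+1 =
   (c ^ 2 * N.*2.+1) * (4 * N.*2.+1 * N.+1.*2.+1))%N by lia.
apply: (leq_trans (leq_mul IH (leqnn _))).
by rewrite (expnSr 16) [leqRHS]mulnCA -!mulnA leq_mul2l; apply/orP; right; lia.
Qed.

Lemma zeros_iter_diffs (R : realFieldType) k :
  zeros (iter k.+1 (@diffs R) [:: 1; -1]) = 'C(2 ^ k.+1, 2 ^ k)%:R.
Proof.
have e : (2 ^ k < (2 ^ k.+1).+1)%N by rewrite ltnS leq_exp2l.
have e2 : (2 ^ k.+1)%:R = 2 * (2 ^ k)%:R :> R by rewrite expnS natrM.
rewrite /zeros (sum_iter_diffs _ (fun c => (c == 0)%:R)) walk_binomial.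
rewrite (bigD1 (Ordinal e)) //= big1 => [|i ik].
  by rewrite e2 subrr eqxx mulr1 addr0.
rewrite e2 -mulrBr mulf_eq0 pnatr_eq0 /= subr_eq0 eqr_nat.
by rewrite -(inj_eq val_inj) /= in ik; rewrite (negPf ik) mulr0.
Qed.

Lemma zeros_iter_diffs_le (R : realFieldType) k (m := (2 ^ k.+1)%N) :
  zeros (iter k.+1 (@diffs R) [:: 1; -1]) ^+ 2 * m%:R <= (2 ^+ m) ^+ 2.
Proof.
rewrite zeros_iter_diffs -!natrX -natrM ler_nat.
have := central_binomial (2 ^ k); rewrite -mul2n -expnS -/m => h.
apply: (leq_trans (leq_trans _ h)); first by rewrite leq_mul2l leqnSn orbT.
by rewrite -[16%N]/(2 ^ 4)%N -!expnM leq_exp2l // /m expnS; lia.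
Qed.

Definition clear_rows (R : realFieldType) n k (J : {set 'I_n}) (A : 'M[R]_(n, k)) :
  'M[R]_(n, k) := \matrix_(i, j) if i \in J then 0 else A i j.

Definition indices n r (f : 'I_r -> 'I_n) : seq 'I_n := [seq f i | i <- enum 'I_r].

Lemma size_flatten_indices n r (fs : seq ('I_r -> 'I_n)) :
  size (flatten (map (@indices n r) fs)) = (size fs * r)%N.
Proof.
elim: fs => //= f fs IH.
by rewrite size_cat IH size_map size_enum_ord mulSn.
Qed.

Lemma sum_signs_combos (R : realFieldType) (V : lmodType R) (W : nmodType)
    n (v : 'I_n -> V) (phi : V -> W) :
  \sum_(b : 'cV[bool]_n) phi (\sum_j (-1) ^+ b j 0 *: v j) =
  \sum_(u <- combos [:: 1; -1] [seq v j | j <- enum 'I_n]) phi u.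
Proof.
elim: n v phi => [|n IH] v phi.
  rewrite (_ : enum 'I_0 = [::]); last by apply/eqP; rewrite -size_eq0 size_enum_ord.
  rewrite big_seq1 (big_pred1 (0 : 'cV_0)) ?big_ord0 // => c.
  by apply/esym/eqP/matrixP => -[].
rewrite enum_ordSl map_cons -map_comp sum_combos_cons sum_consb.
rewrite big_bool !big_cons big_nil addr0 addrC.
by congr (_ + _); rewrite -(IH (v \o lift ord0) (fun u => phi (_ *: v ord0 + u)));
  apply: eq_bigr => b _; rewrite big_ord_recl consb0; congr (phi (_ + _));
  apply: eq_bigr => j _; rewrite consbS.
Qed.

Lemma row_free_row_neq0 (R : realFieldType) n k (A : 'M[R]_(n, k)) i :
  row_free A -> row i A != 0.
Proof.
move=> fA; apply/eqP => h; have := row_free_inj fA.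
move/(_ _ (delta_mx 0 i : 'rV_n) 0); rewrite mul0mx -rowE h => /(_ erefl).
by move/matrixP/(_ 0 i)/eqP; rewrite !mxE !eqxx /= oner_eq0.
Qed.

Lemma free_rows_outside (R : realFieldType) n k (A : 'M[R]_(n, k)) J r :
  (r <= \rank (clear_rows J A))%N ->
  exists f : 'I_r -> 'I_n, [/\ injective f, forall i, f i \notin J
    & row_free (rowsub f A)].
Proof.
set B := clear_rows J A => hr.
pose g := maxrankfun B.
pose f (i : 'I_r) := g (widen_ord hr i).
have fB : row_free (rowsub g B) by exact: maxrowsub_free.
have fJ i : f i \notin J.
  apply/negP => fiJ; have := row_free_row_neq0 (widen_ord hr i) fB.
  by case/eqP; apply/rowP => j; rewrite !mxE fiJ.
have fi : injective f.
  by move=> i j /maxrankfun_inj /(congr1 val) /= /val_inj.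
exists f; split => //.
have e : rowsub f A = rowsub (widen_ord hr) (rowsub g B).
  by apply/matrixP => i j; rewrite !mxE; have := fJ i; rewrite /f => /negPf ->.
rewrite e rowsubE /row_free mxrankMfree //; apply/row_freeP.
exists (rowsub (widen_ord hr) 1%:M)^T; rewrite -rowsubE.
apply/matrixP => i j; rewrite !mxE; congr (_ %:R).
by rewrite eq_sym -!(inj_eq val_inj).
Qed.

(** Greedy choice: the rows used by fewer than m blocks of r rows may be
    cleared, and r independent rows can still be found among the others. *)
Lemma disjoint_free_rows (R : realFieldType) n k (A : 'M[R]_(n, k)) m r :
  (forall J : {set 'I_n}, (#|J| <= m * r)%N -> (r <= \rank (clear_rows J A))%N) ->
  forall l, (l <= m)%N -> exists fs : seq ('I_r -> 'I_n),
    [/\ size fs = l, uniq (flatten (map (@indices n r) fs))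
      & all (fun f => row_free (rowsub f A)) fs].
Proof.
move=> hA; elim=> [|l IH] lm; first by exists [::].
have [fs [sz un fr]] := IH (ltnW lm).
pose J := [set x in flatten (map (@indices n r) fs)].
have hJ : (#|J| <= m * r)%N.
  rewrite cardsE; apply: (leq_trans (card_size _)).
  by rewrite size_flatten_indices sz leq_mul2r ltnW // orbT.
have [f [fi fJ ff]] := free_rows_outside (hA J hJ).
exists (f :: fs); split; first by rewrite /= sz.
  rewrite /= cat_uniq un andbT map_inj_uniq // enum_uniq /=.
  apply/hasPn => x xfs; apply/mapP => -[i _ e].
  by have := fJ i; rewrite inE -e xfs.
by rewrite /= ff.
Qed.

(** If A keeps rank r after clearing any m r of its rows, then it has m disjoint
    blocks of r independent rows.  Fix the signs outside these blocks, and
    decouple the blocks with [hits_flatten_le]: each one contributes the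
    probability that r independent walks of length m all return to 0, which is
    at most m^(-r/2), and the geometric mean of the m bounds is taken. *)
Lemma small_ball (R : realFieldType) n k (A : 'M[R]_(n, k)) a r
    (m := (2 ^ a.+1)%N) (w : 'rV[R]_k) :
  (forall J : {set 'I_n}, (#|J| <= m * r)%N -> (r <= \rank (clear_rows J A))%N) ->
  mean (fun b => (\sum_j (-1) ^+ b j 0 *: row j A == w)%:R) ^+ 2 * m%:R ^+ r
    <= 1 :> R.
Proof.
move=> hA.
have [fs [sz un fr]] := disjoint_free_rows hA (leqnn m).
set js := flatten _ in un.
pose v j := row j A.
pose z : R := zeros (iter a.+1 (@diffs R) [:: 1; -1]).
have z0 : 0 <= z by apply: sumr_ge0 => c _; rewrite ler0n.
have js_hits u : hits [:: 1; -1] (map v js) u <= z ^+ r.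
  have m0 : (0 < m)%N by rewrite expn_gt0.
  rewrite -(@ler_pXn2r _ m) ?nnegrE ?hits_ge0 ?exprn_ge0 //.
  pose bs := map (fun f => map v (indices f)) fs.
  have -> : map v js = flatten bs by rewrite map_flatten -map_comp.
  apply: (le_trans (hits_flatten_le _ _ _)); first by rewrite size_map.
  rewrite big_map -sz.
  elim: fs fr {sz un bs js} => [|f fs IH] fr; first by rewrite big_nil expr0.
  rewrite big_cons /= exprS; apply: ler_pM.
  - exact: hits_ge0.
  - by apply: prodr_ge0 => g _; exact: hits_ge0.
  - case/andP: fr => fF _; rewrite -map_comp (hits_indep _ (v := v \o f)) // => c hc j.
    have e0 : (\row_j c j) *m rowsub f A = 0 *m rowsub f A.
      rewrite mul0mx mulmx_sum_row -[RHS]hc; apply: eq_bigr => i _.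
      by rewrite mxE row_rowsub.
    by have /rowP/(_ j) := row_free_inj fF e0; rewrite !mxE.
  - by apply: IH; case/andP: fr.
pose js' := [seq j <- enum 'I_n | j \notin js].
have pjs : perm_eq (enum 'I_n) (js ++ js').
  apply: uniq_perm; first exact: enum_uniq.
    rewrite cat_uniq un filter_uniq ?enum_uniq // andbT /=.
    by apply/hasPn => x; rewrite mem_filter => /andP[].
  move=> x; rewrite mem_enum mem_cat mem_filter mem_enum andbT.
  by case: (x \in js).
have szjs : (size js + size js' = n)%N.
  by rewrite -size_cat -(perm_size pjs) size_enum_ord.
have sjs : size js = (m * r)%N by rewrite size_flatten_indices sz.
have szc (l : seq 'rV[R]_k) : size (combos [:: 1; -1] l) = (2 ^ size l)%N.
  by elim: l => // b l IH; rewrite /= size_cat size_cat !size_map IH addn0 addnn expnS mul2n.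
have hm : mean (fun b => (\sum_j (-1) ^+ b j 0 *: row j A == w)%:R) <= z ^+ r / (2 ^+ m) ^+ r.
  rewrite /mean (sum_signs_combos v (fun u => (u == w)%:R)).
  rewrite (sum_combos_perm _ _ (perm_map v pjs)) map_cat sum_combos_cat exchange_big /=.
  rewrite ler_pdivrMr ?exprn_gt0 //.
  apply: (@le_trans _ _ (\sum_(u <- combos [:: 1; -1] (map v js')) z ^+ r)).
    apply: ler_sum => u _.
    rewrite (eq_bigr (fun x => (x == w - u)%:R)) => [|x _]; last first.
      by rewrite -[w in x + u == w](subrK u) (inj_eq (addIr u)).
    exact: js_hits.
  rewrite big_const_seq count_predT iter_addr_0 szc size_map.
  rewrite -[in 2 ^+ n]szjs sjs exprD exprM mulrA divfK ?expf_neq0 ?pnatr_eq0 //.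
  by rewrite -[leLHS]mulr_natr natrX.
have mn0 : 0 <= mean (fun b => (\sum_j (-1) ^+ b j 0 *: row j A == w)%:R) :> R.
  by apply: mean_ge0 => b; rewrite ler0n.
apply: (@le_trans _ _ ((z ^+ r / (2 ^+ m) ^+ r) ^+ 2 * m%:R ^+ r)).
  apply: ler_wpM2r; first by rewrite exprn_ge0.
  apply: lerXn2r; rewrite ?nnegrE // divr_ge0 ?exprn_ge0 //.
rewrite -expr_div_n exprAC -exprMn exprn_ile1 //.
  by rewrite mulr_ge0 ?sqr_ge0.
rewrite expr_div_n mulrAC ler_pdivrMr ?exprn_gt0 // mul1r.
exact: zeros_iter_diffs_le.
Qed.

(** * Trace and rank *)

Lemma mxtrace_sum_sqr (R : realFieldType) m n (A : 'M[R]_(m, n)) :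
  \tr (A *m A^T) = \sum_j \sum_i A i j ^+ 2.
Proof.
rewrite exchange_big; apply: eq_bigr => i _; rewrite mxE.
by apply: eq_bigr => j _; rewrite mxE expr2.
Qed.

Lemma mulmx_tr_unit (R : realFieldType) m n (A : 'M[R]_(m, n)) :
  row_free A -> A *m A^T \in unitmx.
Proof.
move=> fA; rewrite -row_free_unit -kermx_eq0; apply/eqP/row_matrixP => i.
rewrite row0; set u := row i _.
have uA : u *m (A *m A^T) = 0 by rewrite -row_mul mulmx_ker row0.
have nu : \tr ((u *m A) *m (u *m A)^T) = 0.
  by rewrite trmx_mul mulmxA -(mulmxA u) uA mul0mx linear0.
suff e : u *m A = 0 *m A by exact: (row_free_inj fA e).
rewrite mul0mx; apply/matrixP => k l; rewrite [RHS]mxE (ord1 k).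
move: nu; rewrite mxtrace_sum_sqr => /eqP.
rewrite psumr_eq0 => [/allP/(_ l (mem_index_enum _))|j _]; last first.
  by apply: sumr_ge0 => ? _; exact: sqr_ge0.
by rewrite /= big_ord1 sqrf_eq0 => /eqP.
Qed.

(** With Q the orthogonal projection on the row space, tr W = tr (W Q) is the
    Frobenius product of W Q and Q; both have Frobenius norm controlled by that
    of Q, whose square is tr Q = rank W. *)
Lemma mxtrace_le_rank (R : realFieldType) n (W : 'M[R]_n) c : 0 <= c ->
  (forall v : 'cV_n, \sum_i (W *m v) i 0 ^+ 2 <= c ^+ 2 * \sum_i v i 0 ^+ 2) ->
  \tr W <= c * (\rank W)%:R.
Proof.
move=> c0 hW.
have [X [Y fY eW]] : exists X : 'M[R]_(n, \rank W), exists2 Y : 'M[R]_(\rank W, n),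
    row_free Y & W = X *m Y.
  by exists (col_base W), (row_base W); rewrite ?row_base_free ?mulmx_base.
set G := invmx (Y *m Y^T).
have uG : Y *m Y^T \in unitmx by exact: mulmx_tr_unit.
have GT : G^T = G by rewrite /G trmx_inv trmx_mul trmxK.
pose Q := Y^T *m (G *m Y).
have QT : Q^T = Q by rewrite /Q !trmx_mul trmxK GT mulmxA.
have YQ : Y *m Q = Y by rewrite /Q !mulmxA mulmxV // mul1mx.
have QQ : Q *m Q = Q by rewrite {1}/Q -!mulmxA YQ.
have WQ : W *m Q = W by rewrite [in LHS]eW -mulmxA YQ -eW.
have trQ : \tr Q = (\rank W)%:R.
  by rewrite /Q mxtrace_mulC -mulmxA mulVmx // mxtrace1.
have nQ : \sum_j \sum_i Q i j ^+ 2 = (\rank W)%:R.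
  by rewrite -mxtrace_sum_sqr QT QQ trQ.
have nW : \sum_j \sum_i W i j ^+ 2 <= c ^+ 2 * (\rank W)%:R.
  rewrite -nQ mulr_sumr; apply: ler_sum => j _.
  have e : W *m col j Q = col j W by rewrite !colE mulmxA WQ.
  have := hW (col j Q); rewrite e.
  under eq_bigr do rewrite mxE.
  by under [X in _ <= _ * X -> _]eq_bigr do rewrite mxE.
have e : \tr W = \sum_(p : 'I_n * 'I_n) W p.2 p.1 * Q p.2 p.1.
  rewrite -{1}WQ -(pair_big xpredT xpredT (fun j i => W i j * Q i j)) /=.
  rewrite exchange_big; apply: eq_bigr => i _; rewrite mxE.
  by apply: eq_bigr => j _; rewrite -{1}QT mxE.
have := cauchy_schwarz_sum (index_enum _) xpredT
  (fun p : 'I_n * 'I_n => W p.2 p.1) (fun p => Q p.2 p.1).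
rewrite -e -!(pair_big xpredT xpredT (fun j i => _ i j ^+ 2)) /= nQ => h.
have r0 : 0 <= (\rank W)%:R :> R by rewrite ler0n.
case: (lerP (\tr W) 0) => [tW|tW]; first by rewrite (le_trans tW) // mulr_ge0.
rewrite -ler_sqr ?nnegrE ?(ltW tW) ?mulr_ge0 //.
apply: (le_trans h); apply: (le_trans (ler_wpM2r r0 nW)).
by rewrite exprMn [(\rank W)%:R ^+ 2]expr2 mulrA.
Qed.

(** Let T be the set of the i in I with pi i outside J.  The matrix 1 - M' with
    M'_(k,i) = s_i M_(i,pi k), for k and i in T, is obtained from the cleared
    matrix by selecting the rows pi k and multiplying column i by - s_i, so its
    rank is no larger.  Up to signs M' is a submatrix of M^T, the rows pi k
    being distinct, hence a contraction: 1 - M' has operator norm at most 2 and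
    [mxtrace_le_rank] applies. *)
Lemma diagonal_defect (R : realFieldType) n (M : 'M[R]_n) (I J : {set 'I_n})
    (pi : 'I_n -> 'I_n) (s : 'I_n -> R)
    (A := \matrix_(j, i) (if i \in I then M i j - s i * (j == pi i)%:R else 0)) :
  M^T *m M = 1%:M -> {in I &, injective pi} -> (forall i, s i ^+ 2 = 1) ->
  \sum_(i in I | pi i \notin J) (1 - s i * M i (pi i)) <=
  2 * (\rank (clear_rows J A))%:R.
Proof.
move=> oM ipi s2.
pose T := [set i in I | pi i \notin J].
have TI i : i \in T -> i \in I by rewrite inE => /andP[].
pose W : 'M[R]_n := \matrix_(k, i)
  if (k \in T) && (i \in T) then (i == k)%:R - s i * M i (pi k) else 0.
have -> : \sum_(i in I | pi i \notin J) (1 - s i * M i (pi i)) = \tr W.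
  rewrite /mxtrace [RHS](bigID (mem T)) /= [X in _ = _ + X]big1 ?addr0.
    by apply: eq_big => [i|i]; rewrite ?inE // => h; rewrite mxE !inE h eqxx.
  by move=> i /negPf h; rewrite mxE h.
have rW : (\rank W <= \rank (clear_rows J A))%N.
  have -> : W = (\matrix_(k, j) (- ((k \in T) && (j == pi k))%:R)) *m
      clear_rows J A *m diag_mx (\row_i (s i *+ (i \in T))).
    rewrite mul_mx_diag; apply/matrixP => k i; rewrite !mxE.
    case kT: (k \in T); last first.
      by rewrite big1 ?mul0r // => j _; rewrite mxE kT /= oppr0 mul0r.
    case iT: (i \in T); last by rewrite mulr0.
    rewrite (bigD1 (pi k)) //= big1 => [|j jk].
      have /negPf kJ : pi k \notin J by move: kT; rewrite inE => /andP[].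
      rewrite addr0 !mxE kJ kT eqxx (TI i iT) /= mulr1n.
      rewrite (inj_in_eq ipi) ?(TI _ kT) ?(TI _ iT) // eq_sym.
      rewrite mulr1n; case: (k == i); rewrite ?mulr1 ?mulr0 /=; last by ring.
      by rewrite -[in LHS](s2 i); ring.
    by rewrite mxE (negPf jk) andbF oppr0 mul0r.
  by apply: (leq_trans (mxrankM_maxl _ _)); exact: mxrankM_maxr.
apply: (@le_trans _ _ (2 * (\rank W)%:R)); last by rewrite ler_pM2l // ler_nat.
apply: mxtrace_le_rank => // v.
pose u i := s i * v i 0 *+ (i \in T).
have u2 i : u i ^+ 2 <= v i 0 ^+ 2.
  rewrite /u; case: (i \in T); first by rewrite mulr1n exprMn s2 mul1r.
  by rewrite mulr0n expr0n sqr_ge0.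
pose y j := \sum_i u i * M i j.
have e i : (W *m v) i 0 = if i \in T then v i 0 - y (pi i) else 0.
  rewrite mxE; case iT: (i \in T); last first.
    by rewrite big1 // => j _; rewrite mxE iT mul0r.
  transitivity (\sum_j ((j == i)%:R * v j 0 *+ (j \in T) - u j * M j (pi i))).
    apply: eq_bigr => j _; rewrite mxE iT /= /u; case: (j \in T) => /=.
      by rewrite !mulr1n; ring.
    by rewrite !mulr0n !mul0r subr0.
  rewrite sumrB; congr (_ - _).
  rewrite (bigD1 i) //= iT eqxx mul1r big1 ?addr0 // => j /negPf ->.
  by rewrite mul0r mul0rn.
apply: (@le_trans _ _ (\sum_i (2 * v i 0 ^+ 2 + (2 * y (pi i) ^+ 2) *+ (i \in T)))).
  apply: ler_sum => i _; rewrite e; case: (i \in T) => /=.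
    have := sqr_ge0 (v i 0 + y (pi i)); rewrite mulr1n; nra.
  by rewrite expr0n mulr0n addr0 mulr_ge0 // sqr_ge0.
have ysum : \sum_i (2 * y (pi i) ^+ 2) *+ (i \in T) <= 2 * \sum_i v i 0 ^+ 2.
  have -> : \sum_i (2 * y (pi i) ^+ 2) *+ (i \in T) = \sum_(j in pi @: T) (2 * y j ^+ 2).
    rewrite big_imset /= => [|i k iT kT]; last by apply: ipi; exact: TI.
    by rewrite [RHS]big_mkcond; apply: eq_bigr => i _; case: (i \in T).
  apply: (@le_trans _ _ (\sum_j (2 * y j ^+ 2))).
    rewrite [leRHS](bigID (mem (pi @: T))) /= lerDl.
    by apply: sumr_ge0 => j _; rewrite mulr_ge0 // sqr_ge0.
  rewrite -mulr_sumr ler_pM2l // (orth_isometry oM u).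
  by apply: ler_sum => i _; exact: u2.
rewrite big_split /= -mulr_sumr; apply: (le_trans (lerD (lexx _) ysum)).
by rewrite le_eqVlt; apply/orP; left; apply/eqP; ring.
Qed.

(** * Rows without a dominant entry *)

Definition preserved (R : realFieldType) n (M : 'M[R]_n) (b : 'cV[bool]_n) : bool :=
  [forall i, signsum (M i) b ^+ 2 == 1].

Lemma quartic_preserved (R : realFieldType) n (M : 'M[R]_n) b :
  preserved M b -> quartic M b = n%:R.
Proof.
move=> /forallP h; rewrite /quartic -[n in RHS]card_ord -sum1_card natr_sum.
by apply: eq_bigr => i _; rewrite (exprM _ 2 2) (eqP (h i)) expr1n.
Qed.

Lemma score0E (R : realType) n (M : 'M[R]_n) :
  score0 M = mean (fun b => (preserved M b)%:R).
Proof.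
rewrite /score0 /mean -sum1_card natr_sum big_mkcond /=.
rewrite card_mx card_bool muln1 natrX; congr (_ / _).
apply: eq_bigr => b _; rewrite inE.
have -> : (M *m sign_col R n b \in hypercube R n) = preserved M b.
  apply: eq_forallb => i; rewrite -sqrf_eq1; congr (_ ^+ 2 == 1).
  by rewrite mxE; apply: eq_bigr => j _; rewrite mxE.
by case: preserved.
Qed.

Definition peak (R : realFieldType) n (M : 'M[R]_n) (i : 'I_n) : 'I_n :=
  [arg max_(j > i) `|M i j|]%O.

Lemma peakP (R : realFieldType) n (M : 'M[R]_n) i j : `|M i j| <= `|M i (peak M i)|.
Proof. by rewrite /peak; case: arg_maxP => // k _; apply. Qed.

Lemma diffuse_rows_card (R : realFieldType) D :
  exists2 c : R, 1 <= c & forall n (M : 'M[R]_n) t, M^T *m M = 1%:M -> 1 <= t ->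
    t ^- D <= mean (fun b => (preserved M b)%:R) ->
    #|[set i | t^-1 < 1 - M i (peak M i) ^+ 2]|%:R <= c * t ^+ 2.
Proof.
have [c c1 hc] := spread_bound R D; exists c => // n M t oM t1 ht.
have t0 : 0 < t by exact: lt_le_trans t1.
set L := [set i | _].
have h : #|L|%:R * t^-1 <= spread M.
  rewrite /spread (bigID (mem L)) /= -[leLHS]addr0; apply: lerD; last first.
    by apply: sumr_ge0 => i _; apply: row_spread_ge0; exact: orth_row_norm.
  rewrite mulrC -sum1_card natr_sum mulr_sumr; apply: ler_sum => i.
  rewrite inE mulr1 => /ltW /le_trans; apply; apply: row_spread_ge.
    exact: orth_row_norm.
  move=> j; rewrite -(real_normK (num_real (M i j))) -[leRHS]real_normK ?num_real //.
  by rewrite ler_sqr ?nnegrE // peakP.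
have := hc n M _ t oM t1 (@quartic_preserved _ _ _) ht.
move=> /(le_trans h); rewrite ler_pdivrMr // => h2.
by rewrite expr2 mulrA.
Qed.

(** Two peaks in one column would make its norm exceed 1. *)
Lemma peak_inj (R : realFieldType) n (M : 'M[R]_n) (I : {set 'I_n}) :
  M^T *m M = 1%:M -> (forall i, i \in I -> 2^-1 < M i (peak M i) ^+ 2) ->
  {in I &, injective (peak M)}.
Proof.
move=> oM h i k iI kI e; apply/eqP/negPn/negP => ik.
have hi := h i iI; have hk := h k kI; rewrite -e in hk.
have := orth_col_norm oM (peak M i).
rewrite (bigD1 i) //= (bigD1 k) /=; last by rewrite eq_sym.
set s := \sum_(_ | _) _.
have s0 : 0 <= s by apply: sumr_ge0 => j _; exact: sqr_ge0.
lra.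
Qed.

(** Unlike [Num.sg], a sign even at 0, so that its square is always 1. *)
Definition sgn1 (R : realFieldType) (x : R) : R := if 0 <= x then 1 else -1.

Lemma sgn1_norm (R : realFieldType) (x : R) : sgn1 x * x = `|x|.
Proof.
rewrite /sgn1; case: ifP => h; first by rewrite mul1r ger0_norm.
by rewrite mulN1r ltr0_norm // ltNge h.
Qed.

Lemma sgn1_sqr (R : realFieldType) (x : R) : sgn1 x ^+ 2 = 1.
Proof. by rewrite /sgn1; case: ifP => _; rewrite ?sqrrN expr1n. Qed.

(** Column i holds the coefficients of the equation f_i = s_i x_(p(i)).  The
    matrix is the transpose of the system, so that the coordinates x_j index
    its rows, as in [small_ball]. *)
Definition defect (R : realFieldType) n (M : 'M[R]_n) (I : {set 'I_n}) : 'M[R]_n :=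
  \matrix_(j, i) (if i \in I
    then M i j - sgn1 (M i (peak M i)) * (j == peak M i)%:R else 0).

(** As f_i is a sign, it is s_i x_(p(i)) or its opposite; in the second case
    the other entries of the row contribute
    f_i - M_(i,p(i)) x_(p(i)) = - (1 + |M_(i,p(i))|) s_i x_(p(i)), which is at
    least 1 in absolute value. *)
Lemma preserved_kernel (R : realFieldType) n (M : 'M[R]_n) (I : {set 'I_n}) b :
  preserved M b ->
  (forall i, i \in I -> `|signsum (off (M i) (peak M i)) b| < 1) ->
  \sum_j (-1) ^+ b j 0 *: row j (defect M I) = 0.
Proof.
move=> /forallP Pb hb; apply/rowP => i; rewrite summxE [RHS]mxE.
case: (boolP (i \in I)) => iI; last first.
  by rewrite big1 // => j _; rewrite !mxE (negPf iI) mulr0.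
set p := peak M i; set s := sgn1 (M i p); pose x : R := (-1) ^+ b p 0.
have -> : \sum_j ((-1) ^+ b j 0 *: row j (defect M I)) 0 i = signsum (M i) b - s * x.
  rewrite (eq_bigr (fun j => M i j * (-1) ^+ b j 0 - s * ((-1) ^+ b j 0 * (j == p)%:R))).
    rewrite sumrB -mulr_sumr; congr (_ - s * _).
    by rewrite (bigD1 p) //= eqxx mulr1 big1 ?addr0 // => j /negPf ->; rewrite mulr0.
  by move=> j _; rewrite !mxE iI -/p -/s; set y := (-1) ^+ _; ring.
have := hb i iI; rewrite signsum_off -/p -/x.
have x2 : x ^+ 2 = 1 by rewrite sqrr_sign.
have sx2 : (s * x) ^+ 2 = 1 by rewrite exprMn x2 sgn1_sqr mulr1.
have := Pb i; rewrite -{1}sx2 eqf_sqr => /orP[/eqP -> _|/eqP -> h]; first by rewrite subrr.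
suff : 1 <= `|- (s * x) - M i p * x| by rewrite leNgt h.
have -> : - (s * x) - M i p * x = - (s * x * (1 + s * M i p)).
  have -> : M i p * x = s ^+ 2 * (M i p * x) by rewrite sgn1_sqr mul1r.
  by ring.
rewrite normrN normrM sgn1_norm.
have -> : `|s * x| = 1.
  by apply/eqP; rewrite -sqr_norm_eq1 sx2.
by rewrite mul1r ger0_norm ?addr_ge0 // lerDl.
Qed.

Definition peaked_rows (R : realFieldType) n (M : 'M[R]_n) (t : R) : {set 'I_n} :=
  [set i | 1 - M i (peak M i) ^+ 2 <= t^-1].

(** A union bound over the at most t^D peaked rows, each of which has a large
    tail with probability at most c t^(-2D-1). *)
Lemma defect_kernel_mean (R : realFieldType) D :
  exists2 c : R, 1 <= c & forall n (M : 'M[R]_n) t, M^T *m M = 1%:M ->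
    2 * c <= t -> n%:R <= t ^+ D ->
    t ^- D <= mean (fun b => (preserved M b)%:R) ->
    t ^- D / 2 <= mean (fun b =>
      (\sum_j (-1) ^+ b j 0 *: row j (defect M (peaked_rows M t)) == 0)%:R).
Proof.
have [c c1 hc] := tail_bound R (D.*2.+1); exists c => // n M t oM ct nt ht.
set I := peaked_rows M t.
have t1 : 1 <= t by lra.
have t0 : 0 < t by lra.
pose tail i b : R := (1 <= `|signsum (off (M i) (peak M i)) b|)%R%:R.
set K := mean _.
have h1 : mean (fun b => (preserved M b)%:R) <= \sum_(i in I) mean (tail i) + K.
  have -> : \sum_(i in I) mean (tail i) = mean (fun b => \sum_i (i \in I)%:R * tail i b).
    rewrite mean_sum big_mkcond; apply: eq_bigr => i _; rewrite meanZ.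
    by case: (i \in I); rewrite ?mul1r ?mul0r.
  rewrite -meanD; apply: ler_mean => b.
  have s0 : 0 <= \sum_i (i \in I)%:R * tail i b.
    by apply: sumr_ge0 => i _; rewrite mulr_ge0 ?ler0n.
  case Pb: (preserved M b); last by rewrite addr_ge0 ?ler0n.
  case: (boolP [forall i in I, `|signsum (off (M i) (peak M i)) b| < 1]).
    move=> /forall_inP h; rewrite preserved_kernel // eqxx lerDr //.
  rewrite negb_forall_in => /exists_inP[i iI]; rewrite -leNgt => h.
  apply: (@le_trans _ _ (\sum_i (i \in I)%:R * tail i b)); last by rewrite lerDl ler0n.
  rewrite (bigD1 i) //= iI /tail h mul1r lerDl.
  by apply: sumr_ge0 => k _; rewrite mulr_ge0 ?ler0n.
have h2 : \sum_(i in I) mean (tail i) <= t ^- D / 2.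
  apply: (@le_trans _ _ (\sum_(i : 'I_n) (c / t ^+ D.*2.+1))).
    rewrite [leRHS](bigID (mem I)) /= -[leLHS]addr0; apply: lerD; last first.
      by apply: sumr_ge0 => i _; rewrite divr_ge0 ?exprn_ge0 //; lra.
    apply: ler_sum => i; rewrite inE => iI.
    apply: (@le_trans _ _ (c / t ^+ (2 ^ D.*2.+1))).
      by apply: hc => //; rewrite off_norm ?(orth_row_norm oM).
    apply: ler_wpM2l; first by lra.
    by rewrite lef_pV2 ?posrE ?exprn_gt0 // ler_weXn2l // ltnW // ltn_expl.
  rewrite sumr_const card_ord -[leLHS]mulr_natl.
  apply: (@le_trans _ _ (t ^+ D * (c / t ^+ D.*2.+1))).
    by apply: ler_wpM2r => //; rewrite divr_ge0 ?exprn_ge0 //; lra.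
  have e : t ^+ D != 0 by rewrite expf_neq0 // gt_eqF.
  have -> : t ^+ D * (c / t ^+ D.*2.+1) = t ^- D * (c / t).
    rewrite -addnn exprS exprD; field.
    by rewrite e gt_eqF.
  apply: ler_wpM2l; first by rewrite invr_ge0 exprn_ge0 // ltW.
  by rewrite ler_pdivrMr // mulrC ler_pdivlMr // mulrC.
lra.
Qed.

Lemma dyadic_below (R : archiRealFieldType) (t : R) : 2 <= t ->
  exists a, (2 ^ a.+1)%:R <= t < 2 * (2 ^ a.+1)%:R.
Proof.
move=> t2; have t0 : 0 <= t by lra.
pose T := Num.truncn t.
have T2 : (2 <= T)%N by rewrite /T truncn_ge_nat.
have /andP[lo hi] := trunc_log_bounds (isT : (1 < 2)%N) (ltnW T2).
have k0 : (0 < trunc_log 2 T)%N by rewrite trunc_log_gt0.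
exists (trunc_log 2 T).-1; rewrite prednK //.
have /andP[l u] := truncn_itv t0.
rewrite (le_trans _ l) ?ler_nat //= (lt_le_trans u) //.
by rewrite -natrM -expnS ler_nat.
Qed.

(** An exceptional row is diffuse, or has its peak in the set J of deleted
    coordinates, or takes part in the trace bound of [diagonal_defect]; the
    constant K adds the three contributions. *)
Lemma exceptional_rows_card (R : archiRealFieldType) D :
  exists K t0 : R, [/\ 0 < K, 1 <= t0 & forall n (M : 'M[R]_n) t,
    M^T *m M = 1%:M -> t0 <= t -> n%:R <= t ^+ D ->
    t ^- D <= mean (fun b => (preserved M b)%:R) ->
    #|[set i | `|M i (peak M i)| < 1 - t ^- 2]|%:R <= K * t ^+ 2].
Proof.
have [c1 c11 h1] := diffuse_rows_card R D.
have [c2 c21 h2] := defect_kernel_mean R D.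
(* The exponent r makes m^(-r/2), with m > t / 2, smaller than t^-D / 2 for
   large t. *)
pose r := (2 * D.+1)%N.
exists (c1 + 3 * r%:R), (2 * c2 + 2 ^+ D.+2 + 3); split.
- by rewrite ltr_wpDr ?mulr_ge0 ?ler0n //; lra.
- by have : 0 <= (2 : R) ^+ D.+2 by [rewrite exprn_ge0]; lra.
move=> n M t oM tt nt ht.
have p2 : 0 <= (2 : R) ^+ D.+2 by rewrite exprn_ge0.
have t3 : 3 <= t by lra.
have t0 : 0 < t by lra.
have := h1 n M t oM _ ht; have := h2 n M t oM _ nt ht.
set I := peaked_rows M t; set L := [set i | t^-1 < _].
move=> hK hL; have {}hK := hK ltac:(lra); have {}hL := hL ltac:(lra).
have [a /andP[ma am]] := @dyadic_below R t ltac:(lra).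
set m := (2 ^ a.+1)%N in ma am.
have [J cJ rJ] : exists2 J : {set 'I_n}, (#|J| <= m * r)%N &
    (\rank (clear_rows J (defect M I)) < r)%N.
  case: (boolP [exists J : {set 'I_n}, (#|J| <= m * r)%N &&
      (\rank (clear_rows J (defect M I)) < r)%N]).
    by case/existsP => J /andP[]; exists J.
  rewrite negb_exists => /forallP hJ; exfalso.
  have robust (J : {set 'I_n}) : (#|J| <= m * r)%N ->
      (r <= \rank (clear_rows J (defect M I)))%N.
    by move=> cJ; have := hJ J; rewrite negb_and cJ /= -leqNgt.
  have := small_ball 0 robust; rewrite -/m; apply/negP; rewrite -ltNge.
  set K := mean _ in hK *.
  have kt : 2^-1 * t ^- D * ((t / 2) ^+ D.+1) <= K * m%:R ^+ D.+1.
    apply: ler_pM.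
    - by rewrite mulr_ge0 ?invr_ge0 ?exprn_ge0 // ltW.
    - by rewrite exprn_ge0 // divr_ge0 // ltW.
    - by rewrite mulrC.
    apply: lerXn2r; rewrite ?nnegrE ?divr_ge0 ?ler0n ?(ltW t0) //.
    by rewrite ler_pdivrMr // mulrC ltW.
  have e : 2^-1 * t ^- D * ((t / 2) ^+ D.+1) = t / 2 ^+ D.+2.
    rewrite expr_div_n [t ^+ D.+1]exprS [2 ^+ D.+2]exprS; field.
    by rewrite !expf_neq0 // gt_eqF.
  rewrite e in kt.
  have big : 1 < t / 2 ^+ D.+2.
    by rewrite ltr_pdivlMr ?exprn_gt0 // mul1r; lra.
  have Km : 1 < K * m%:R ^+ D.+1 by exact: lt_le_trans kt.
  rewrite /r mulnC exprM -exprMn.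
  by rewrite exprn_egt1.
have inj : {in I &, injective (peak M)}.
  apply: (peak_inj oM) => i; rewrite inE => hi.
  have : t^-1 <= 3^-1 by rewrite lef_pV2 ?posrE.
  lra.
set B := [set i | _].
have sub : B \subset L :|: [set i in I | peak M i \in J]
     :|: (B :&: [set i in I | peak M i \notin J]).
  apply/fintype.subsetP => i iB; rewrite !inE; move: iB; rewrite inE => ->.
  by case: (lerP _ t^-1) => //= _; case: (_ \in J).
have cB : (#|B| <= #|L| + #|J| + #|B :&: [set i in I | peak M i \notin J]|)%N.
  apply: (leq_trans (subset_leq_card sub)); apply: (leq_trans (leq_card_setU _ _)).
  rewrite leq_add2r; apply: (leq_trans (leq_card_setU _ _)); rewrite leq_add2l.
  rewrite -(card_in_imset (f := peak M)); last first.
    by move=> i k /setIdP[iI _] /setIdP[kI _]; exact: inj.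
  by apply/subset_leq_card/fintype.subsetP => _ /imsetP[i /setIdP[_ iJ] ->].
have cJt : #|J|%:R <= r%:R * t ^+ 2.
  apply: (@le_trans _ _ (m * r)%:R); first by rewrite ler_nat.
  rewrite natrM mulrC; apply: ler_wpM2l; first exact: ler0n.
  by apply: (le_trans ma); rewrite expr2 ler_peMl //; lra.
have cT : #|B :&: [set i in I | peak M i \notin J]|%:R <= 2 * r%:R * t ^+ 2.
  have := diagonal_defect J oM inj (fun i => sgn1_sqr (M i (peak M i))).
  rewrite -/(defect M I) => hd.
  have {}hd := le_trans hd (ler_wpM2l (ler0n R 2) (_ : _ <= r%:R)).
  have : #|B :&: [set i in I | peak M i \notin J]|%:R * t ^- 2 <= 2 * r%:R.
    apply: le_trans (hd _); last by rewrite ler_nat ltnW.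
    rewrite mulr_natl -sumr_const.
    rewrite [leRHS](bigID (mem B)) /= -[leLHS]addr0; apply: lerD; last first.
      apply: sumr_ge0 => i _; rewrite sgn1_norm subr_ge0.
      rewrite -(@ler_pXn2r _ 2) ?nnegrE // expr1n real_normK ?num_real //.
      rewrite -(orth_row_norm oM i) (bigD1 (peak M i)) //= lerDl.
      by apply: sumr_ge0 => j _; exact: sqr_ge0.
    rewrite (eq_bigl (fun i => (i \in I) && (peak M i \notin J) && (i \in B))); last first.
      by move=> i; rewrite finset.in_setI andbC inE.
    apply: ler_sum => i /andP[_]; rewrite inE sgn1_norm; lra.
  by rewrite ler_pdivrMr ?exprn_gt0.
have : #|B|%:R <= #|L|%:R + #|J|%:R + #|B :&: [set i in I | peak M i \notin J]|%:R :> R.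
  by rewrite -!natrD ler_nat.
move: hL cJt cT; set x := t ^+ 2; lra.
Qed.

Lemma large_entry_unique (R : realFieldType) n (M : 'M[R]_n) i j k (a : R) :
  M^T *m M = 1%:M -> 3 / 4 <= a -> a <= `|M i j| -> a <= `|M i k| -> j = k.
Proof.
move=> oM ha hj hk; apply/eqP/negPn/negP => jk.
have := orth_row_norm oM i; rewrite (bigD1 j) //= (bigD1 k) 1?eq_sym //=.
set s := \sum_(_ | _) _.
have s0 : 0 <= s by apply: sumr_ge0 => l _; exact: sqr_ge0.
rewrite -(real_normK (num_real (M i j))) -(real_normK (num_real (M i k))).
nra.
Qed.

Theorem theorem1p4 (R : realType) (eps C : R) :
  0 < eps < 1 -> 0 < C ->
  exists K1 K2 : R, [/\ 0 < K1, 0 < K2 &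
    forall (n : nat) (M : 'M[R]_n), (0 < n)%N ->
      orthogonal_mx M -> n%:R `^ (- C) <= score0 M ->
      #|[set i : 'I_n |
          ~~ `[< exists! j : 'I_n, 1 - K2 * n%:R `^ (-1 + eps) <= `|M i j| >]]|%:R
      <= K1 * n%:R `^ (1 - eps)].
Proof.
move=> /andP[e0 e1] C0.
pose a := (1 - eps) / 2; have a0 : 0 < a by rewrite /a; lra.
(* a D >= 1 + C gives both n <= t^D and t^-D <= n^-C. *)
pose D := (Num.truncn ((1 + C) / a)).+1.
have aD : 1 + C <= a * D%:R.
  by rewrite mulrC -ler_pdivrMr // ltW // truncnS_gt.
have [K [t0 [K0 t01 hK]]] := exceptional_rows_card R D.
exists (K + (t0 + 2) ^+ D), 1; split => //.
  by rewrite addr_gt0 // exprn_gt0 //; lra.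
move=> n M n0 oM hs.
have n1 : 1 <= n%:R :> R by rewrite (ler_nat R 1).
set N := n%:R in n1 hs *.
pose t := N `^ a.
have t1 : 1 <= t by rewrite /t -[1](powRr0 N) ler_powR // ltW.
have tX k : t ^+ k = N `^ (a * k%:R) by rewrite powRrM powR_mulrn ?powR_ge0.
have t2 : N `^ (1 - eps) = t ^+ 2 by rewrite tX; congr (_ `^ _); rewrite /a; field.
have -> : N `^ (-1 + eps) = t ^- 2.
  by rewrite -t2 -powRN; congr (_ `^ _); ring.
have Nt : N <= t ^+ D.
  rewrite -[leLHS]powRr1 ?ler0n // tX; apply: ler_powR => //; lra.
have ht : t ^- D <= score0 M.
  apply: le_trans hs; rewrite powRN lef_pV2 ?posrE ?exprn_gt0 ?powR_gt0 //; [|lra|lra].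
  by rewrite tX; apply: ler_powR => //; lra.
rewrite t2 mul1r; set B := [set i | _].
have tt : 1 <= t ^+ 2 by rewrite exprn_ege1.
(* For bounded n the constant K1 exceeds the number of rows; t >= 2 is what
   makes a large entry unique. *)
case: (ltrP t (t0 + 2)) => ht0.
  apply: (@le_trans _ _ N); first by rewrite ler_nat -[leqRHS]card_ord max_card.
  apply: (le_trans Nt); apply: (@le_trans _ _ ((t0 + 2) ^+ D)).
    by apply: lerXn2r; rewrite ?nnegrE; lra.
  have p0 : 0 <= (t0 + 2) ^+ D by rewrite exprn_ge0 //; lra.
  by nra.
have := hK n M t oM _ Nt _; rewrite -score0E => /(_ _ ht) h.
apply: (@le_trans _ _ (K * t ^+ 2)); last first.
  by rewrite ler_wpM2r ?lerDl ?exprn_ge0 //; lra.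
apply: le_trans (h _); last by lra.
rewrite ler_nat; apply/subset_leq_card/fintype.subsetP => i; rewrite !inE.
apply: contraR; rewrite -leNgt => hi; apply/asboolP.
exists (peak M i); split => // j hj.
apply: (large_entry_unique oM _ hi hj).
have : t ^- 2 <= 4^-1.
  rewrite lef_pV2 ?posrE //; last lra.
  by nra.
lra.
Qed.
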